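(* Let $\tilde\Sigma',\tilde h$ be good for $\Sigma',h$. Let $\widetilde{\check\Sigma}{}'$ be the normal fan of $\tilde\nabla+\tilde\nabla'$ in $M_{\mathbb R}\oplus\mathbb R$, and let $\widetilde{\check h}(m,l)=-\inf\{\langle(m,l),(n,l')\rangle\mid(n,l')\in\tilde\nabla+\tilde\nabla'\}$. Then $\widetilde{\check\Sigma}{}'$ and $\widetilde{\check h}$ are good for $\check\Sigma',\check h$.
   Context: **Nef-partitions.** $M$ is a free abelian group of finite rank, $N=\mathrm{Hom}(M,\mathbb Z)$, $M_{\mathbb R}=M\otimes\mathbb R$, $N_{\mathbb R}=N\otimes\mathbb R$. $\Delta\subseteq M_{\mathbb R}$ is a reflexive polytope with dual $\Delta^*=\{y\mid\langle x,y\rangle\ge-1\ \forall x\in\Delta\}$; $\Sigma$ is the (inner) normal fan of $\Delta$ in $N_{\mathbb R}$ (cones over proper faces of $\Delta^*$), $\Sigma(1)$ the primitive generators of its rays, $\varphi$ the $\Sigma$-piecewise linear function with value $1$ on $\Sigma(1)$. $\Delta=\Delta_1+\cdots+\Delta_r$ is a Minkowski decomposition into lattice polytopes which is a nef-partition: with $\varphi_i(y)=-\inf_{x\in\Delta_i}\langle x,y\rangle$ (so $\varphi=\sum\varphi_i$), $\varphi_i(e)\in\{0,1\}$ for $e\in\Sigma(1)$. $\nabla_i=\mathrm{Conv}(\{0\}\cup\{e\in\Sigma(1)\mid\varphi_i(e)=1\})$, $\nabla=\sum\nabla_i$, reflexive with dual $\nabla^*=\mathrm{Conv}(\Delta_1,\ldots,\Delta_r)$;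 $\check\Sigma$ is the normal fan of $\nabla$ in $M_{\mathbb R}$, $\check\varphi_i(x)=-\inf_{y\in\nabla_i}\langle x,y\rangle$, $\check\varphi=\sum\check\varphi_i$. **Extra data.** Convex means $g(x+y)\le g(x)+g(y)$; strictly convex on a fan means convex with the maximal cones exactly the maximal domains of linearity. Fix subdivisions $\Sigma'$ of $\Sigma$, $\check\Sigma'$ of $\check\Sigma$ giving partial crepant resolutions (rays generated by lattice points of $\partial\Delta^*$, resp. $\partial\nabla^*$), and integral piecewise linear functions $h$ on $N_{\mathbb R}$, $\check h$ on $M_{\mathbb R}$, strictly convex on $\Sigma'$, resp. $\check\Sigma'$, with $h'=h-\varphi$, $\check h'=\check h-\check\varphi$ convex. $\Delta^{h'}=\{x\in M_{\mathbb R}\mid\langle x,y\rangle\ge-h'(y)\ \forall y\}$, $\nabla^{\check h'}=\{y\in N_{\mathbb R}\mid\langle x,y\rangle\ge-\check h'(x)\ \forall x\}$. **Good data.** $\tilde\Delta_i=\{(m,l)\in M_{\mathbb R}\oplus\mathbb R\mid m\in\Delta_i,\ l\ge\check h'(m)\}$, $\tilde\Delta=\sum\tilde\Delta_i$, $\tilde\Sigma$ its normal fan in $N_{\mathbb R}\oplus\mathbb R$, $\tilde\varphi(\tilde n)=-\inf_{\tilde m\in\tilde\Delta}\langle\tilde n,\tilde m\rangle$. A subdivision $\tilde\Sigma'$ of $\tilde\Sigma$ is good for $\Sigma'$ if $\{\sigma\cap(N_{\mathbb R}\times\{0\})\mid\sigma\in\tilde\Sigma'\}=\Sigma'$ and every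 ray of $\tilde\Sigma'$ not in $N_{\mathbb R}\times\{0\}$ is generated by a primitive $(n,1)$ with $n\in\nabla^{\check h'}$. $\tilde\Sigma'$ with an integral piecewise linear function $\tilde h$ on it is good for $\Sigma',h$ if moreover $\tilde h|_{N_{\mathbb R}\times\{0\}}=h$, $\tilde h$ is strictly convex on $\tilde\Sigma'$, and $\tilde h'=\tilde h-\tilde\varphi$ is convex. **Dual notions.** $\tilde\nabla=\{(n,l)\in N_{\mathbb R}\oplus\mathbb R\mid n\in\nabla,\ l\ge h'(n)\}$, $\widetilde{\check\Sigma}$ its normal fan in $M_{\mathbb R}\oplus\mathbb R$, $\widetilde{\check\varphi}(\tilde m)=-\inf_{\tilde n\in\tilde\nabla}\langle\tilde m,\tilde n\rangle$, and $\tilde\nabla'=\{(n,l)\mid n\in\nabla^{\check h'},\ l\ge\tilde h'(n,1)\}$. A fan and function $\mathcal F,g$ on $M_{\mathbb R}\oplus\mathbb R$ are good for $\check\Sigma',\check h$ if $\mathcal F$ is a subdivision of $\widetilde{\check\Sigma}$ restricting to $\check\Sigma'$ on $M_{\mathbb R}\times\{0\}$, every ray of $\mathcal F$ not in $M_{\mathbb R}\times\{0\}$ is generated by a primitive $(m,1)$ with $m\in\Delta^{h'}$, $g$ is integral piecewise linear and strictly convex on $\mathcal F$, $g|_{M_{\mathbb R}\times\{0\}}=\check h$, and $g-\widetilde{\check\varphi}$ is convex. *)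

(* Defs.v *)
From HB Require Import structures.
From mathcomp Require Import all_boot all_order all_algebra archimedean.
From mathcomp Require Import all_classical all_reals all_analysis.

Set Implicit Arguments.
Unset Strict Implicit.
Unset Printing Implicit Defensive.

Import Order.TTheory GRing.Theory Num.Theory.
Import numFieldNormedType.Exports.

Local Open Scope classical_set_scope.
Local Open Scope ring_scope.

(* A basis of M and the dual basis of N identify both M_R and N_R with
   'rV[R]_n, the lattices with the integral row vectors, and the duality
   pairing with [dot]; M_R (+) R and N_R (+) R become 'rV[R]_(n + 1).  Every
   notion below can thus be used on either side of the duality. *)

Definition dot (R : realType) (n : nat) (x y : 'rV[R]_n) : R :=
  \sum_(i < n) x 0 i * y 0 i.

Definition integral (R : realType) (n : nat) (v : 'rV[R]_n) : Prop :=
  v \is a mxOver Num.int.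

(* The condition fails for v = 0 (take k = 0). *)
Definition primitive (R : realType) (n : nat) (v : 'rV[R]_n) : Prop :=
  integral v /\
  forall (k : nat) (w : 'rV[R]_n), integral w -> v = k%:R *: w -> k = 1%N.

Definition pt (R : realType) (n : nat) (m : 'rV[R]_n) (l : R) : 'rV[R]_(n + 1) :=
  row_mx m (const_mx l).

Definition conv (R : realType) (n : nat) (A : set 'rV[R]_n) : set 'rV[R]_n :=
  smallest (@convex_set R 'rV[R]_n) A.

Definition lattice_polytope (R : realType) (n : nat) (P : set 'rV[R]_n) : Prop :=
  exists s : seq 'rV[R]_n,
    (forall v, v \in s -> integral v) /\ P = conv [set` s].

Definition polar (R : realType) (n : nat) (P : set 'rV[R]_n) : set 'rV[R]_n :=
  [set y | forall x, P x -> -1 <= dot x y].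

Definition reflexive_polytope (R : realType) (n : nat) (P : set 'rV[R]_n) : Prop :=
  [/\ lattice_polytope P, P° 0 & lattice_polytope (polar P)].

Definition boundary (R : realType) (n : nat) (P : set 'rV[R]_n) : set 'rV[R]_n :=
  closure P `\` P°.

Definition minkowski_sum (R : realType) (n r : nat) (P : 'I_r -> set 'rV[R]_n) :
    set 'rV[R]_n :=
  [set x | exists f : 'I_r -> 'rV[R]_n,
     (forall i, P i (f i)) /\ x = \sum_(i < r) f i].

(* Nonempty faces, P included (y = 0).  If P is a polyhedral cone, the minimum
   exists only for y in the dual cone of P and equals 0: this is then the usual
   notion of a face of a cone. *)
Definition face (R : realType) (n : nat) (P F : set 'rV[R]_n) : Prop :=
  F !=set0 /\
  exists y, F = [set x | P x /\ forall x', P x' -> dot x y <= dot x' y].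

(* The value is meaningful only where the infimum is finite: for the polyhedra
   with recession cone {0} x R_{>=0} considered below, on the half-space of the
   (m, l) with l >= 0, which is the support of their normal fan. *)
Definition support_fun (R : realType) (n : nat) (P : set 'rV[R]_n) (y : 'rV[R]_n) : R :=
  - inf [set dot x y | x in P].

Definition newton (R : realType) (n : nat) (f : 'rV[R]_n -> R) : set 'rV[R]_n :=
  [set x | forall y, - f y <= dot x y].

Definition epigraph (R : realType) (n : nat) (P : set 'rV[R]_n) (f : 'rV[R]_n -> R) :
    set 'rV[R]_(n + 1) :=
  [set p | exists m l, [/\ P m, f m <= l & p = pt m l]].

Definition convex_cone (R : realType) (n : nat) (C : set 'rV[R]_n) : Prop :=
  [/\ C 0,
      forall x y, C x -> C y -> C (x + y)
    & forall (t : R) x, 0 <= t -> C x -> C (t *: x)].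

Definition ray (R : realType) (n : nat) (v : 'rV[R]_n) : set 'rV[R]_n :=
  [set x | exists2 t : R, 0 <= t & x = t *: v].

Definition is_ray (R : realType) (n : nat) (C : set 'rV[R]_n) : Prop :=
  exists2 v, v != 0 & C = ray v.

Definition rational_cone (R : realType) (n : nat) (C : set 'rV[R]_n) : Prop :=
  exists s : seq 'rV[R]_n,
    (forall v, v \in s -> integral v) /\
    C = smallest (@convex_cone R n) [set` s].

Definition strongly_convex (R : realType) (n : nat) (C : set 'rV[R]_n) : Prop :=
  forall x, C x -> C (- x) -> x = 0.

Definition is_fan (R : realType) (n : nat) (F : set (set 'rV[R]_n)) : Prop :=
  [/\ finite_set F,
      forall C, F C -> rational_cone C /\ strongly_convex C,
      forall C D, F C -> face C D -> F D
    & forall C D, F C -> F D -> face C (C `&` D)].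

Definition fan_support (R : realType) (n : nat) (F : set (set 'rV[R]_n)) : set 'rV[R]_n :=
  \bigcup_(C in F) C.

Definition ray_generators (R : realType) (n : nat) (F : set (set 'rV[R]_n)) :
    set 'rV[R]_n :=
  [set v | primitive v /\ F (ray v)].

Definition subdivision (R : realType) (n : nat) (F' F : set (set 'rV[R]_n)) : Prop :=
  [/\ is_fan F',
      fan_support F' = fan_support F
    & forall C', F' C' -> exists2 C, F C & C' `<=` C].

(* Applied with B the dual of the reflexive polytope whose normal fan is F. *)
Definition crepant_subdivision (R : realType) (n : nat) (B : set 'rV[R]_n)
    (F' F : set (set 'rV[R]_n)) : Prop :=
  subdivision F' F /\
  forall C, F' C -> is_ray C ->
    exists v, [/\ integral v, boundary B v & C = ray v].

Definition normal_cone (R : realType) (n : nat) (P F : set 'rV[R]_n) : set 'rV[R]_n :=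
  [set y | forall x x', F x -> P x' -> dot x y <= dot x' y].

Definition normal_fan (R : realType) (n : nat) (P : set 'rV[R]_n) : set (set 'rV[R]_n) :=
  [set normal_cone P F | F in face P].

(* Functions are total, but the conditions below only involve their values on
   the support of the fan. *)

Definition linear_on (R : realType) (n : nat) (D : set 'rV[R]_n) (g : 'rV[R]_n -> R) : Prop :=
  exists m, forall x, D x -> g x = dot m x.

Definition piecewise_linear (R : realType) (n : nat) (F : set (set 'rV[R]_n))
    (g : 'rV[R]_n -> R) : Prop :=
  forall C, F C -> linear_on C g.

Definition integral_piecewise_linear (R : realType) (n : nat) (F : set (set 'rV[R]_n))
    (g : 'rV[R]_n -> R) : Prop :=
  piecewise_linear F g /\
  forall v, fan_support F v -> integral v -> g v \is a Num.int.

Definition convex_on (R : realType) (n : nat) (D : set 'rV[R]_n) (g : 'rV[R]_n -> R) : Prop :=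
  forall x y, D x -> D y -> g (x + y) <= g x + g y.

Definition linearity_domain (R : realType) (n : nat) (S : set 'rV[R]_n) (g : 'rV[R]_n -> R)
    (D : set 'rV[R]_n) : Prop :=
  [/\ convex_cone D, D `<=` S & linear_on D g].

Definition maximal_sets (T : Type) (F : set (set T)) : set (set T) :=
  [set C | F C /\ forall D, F D -> C `<=` D -> D = C].

Definition strictly_convex (R : realType) (n : nat) (F : set (set 'rV[R]_n))
    (g : 'rV[R]_n -> R) : Prop :=
  convex_on (fan_support F) g /\
  maximal_sets F = maximal_sets (linearity_domain (fan_support F) g).

Definition nef_partition (R : realType) (n r : nat) (Delta : set 'rV[R]_n)
    (Deltas : 'I_r -> set 'rV[R]_n) : Prop :=
  [/\ Delta = minkowski_sum Deltas,
      forall i, lattice_polytope (Deltas i)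
    & forall i e, ray_generators (normal_fan Delta) e ->
        support_fun (Deltas i) e = 0 \/ support_fun (Deltas i) e = 1].

Definition nablas (R : realType) (n r : nat) (Delta : set 'rV[R]_n)
    (Deltas : 'I_r -> set 'rV[R]_n) (i : 'I_r) : set 'rV[R]_n :=
  conv (0 |` [set e | ray_generators (normal_fan Delta) e /\
                      support_fun (Deltas i) e = 1]).

(* [F] is good for [S'], where F subdivides the normal fan of [P].  In the
   paper's notation (P, Q) is (Delta~, nabla^{h-check'}) on the N side and
   (nabla~, Delta^{h'}) on the M side. *)
Definition good_fan (R : realType) (n : nat) (P : set 'rV[R]_(n + 1)) (Q : set 'rV[R]_n)
    (S' : set (set 'rV[R]_n)) (F : set (set 'rV[R]_(n + 1))) : Prop :=
  [/\ subdivision F (normal_fan P),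
      [set [set y | C (pt y 0)] | C in F] = S'
    & forall C, F C -> is_ray C -> ~ (C `<=` [set pt y 0 | y in setT]) ->
        exists q, [/\ Q q, primitive (pt q 1) & C = ray (pt q 1)]].

Definition good (R : realType) (n : nat) (P : set 'rV[R]_(n + 1)) (Q : set 'rV[R]_n)
    (S' : set (set 'rV[R]_n)) (h : 'rV[R]_n -> R)
    (F : set (set 'rV[R]_(n + 1))) (g : 'rV[R]_(n + 1) -> R) : Prop :=
  good_fan P Q S' F /\
  [/\ integral_piecewise_linear F g,
      forall y, g (pt y 0) = h y,
      strictly_convex F g
    & convex_on (fan_support F) (g \- support_fun P)].

(* Main.v *)
Require Import Defs.
From HB Require Import structures.
From mathcomp Require Import all_boot all_order all_algebra archimedean.
From mathcomp Require Import all_classical all_reals all_analysis.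
From mathcomp Require Import ring lra.

Set Implicit Arguments.
Unset Strict Implicit.
Unset Printing Implicit Defensive.

Import Order.TTheory GRing.Theory Num.Theory.
Import numFieldNormedType.Exports.

Local Open Scope classical_set_scope.
Local Open Scope ring_scope.

(** The proof rests on one identity.  Write [th'(x)] for [th' (pt x 1)].  Then
    [tsum = tnabla + tnabla'] is the part of the epigraph of the convex function
    [th'] that lies over [newton ch], the Minkowski sum of [nabla] and
    [newton ch'] ([tsum_graph], [tsum_below]).

    One inclusion is the subadditivity of [th'], whose restriction to height [0]
    is [h'].  For the other, take [x] in [newton ch].  A cone of the good fan that
    contains [(x, 1)] is generated by points [(v, 1)] with [v] in [newton ch'] and
    by points [(e, 0)] with [e] a lattice point on the boundary of the dual of
    [Delta]; so [(x, 1) = (n2, 1) + (n1, 0)] with [n2] in [newton ch'] and [n1] a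
    combination of points [e] ([decomposition]).  The weight of [n1] in the piece
    [i] is the value at [(x, 1)] of the support function of the [i]-th summand of
    [tDelta], because all these support functions are linear on the cone.  It is
    at most [1] by definition of [newton ch], so that [n1] is in [nabla].  As
    [th'] is linear on the cone too, [th'(x) = h'(n1) + th'(n2)].

    The conclusions are read off from this.  On horizontal vectors the support
    function of [tsum] is [ch], so its normal fan restricts to the normal fan of a
    polytope with support function [ch].  That fan and [cSigma'] have the same
    maximal cones, namely the maximal domains of linearity of [ch], and hence
    coincide ([base_fan], [tsum_slices]).  A ray [(m, 1)] of the normal fan comes
    from a facet over which [th'] is affine of slope [- m]; the slope of a
    piecewise linear function with integral values on a full-dimensional rational
    cone is integral, and convexity of [th'] places [m] in [newton h']
    ([tsum_ray]).  The generators of [tsum] are sums of lattice points, hence the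
    integrality of its support function ([gen_epigraphs], [gen_tnabla']).

    Two bodies of theory support this.  The first is the finite theory of
    rational cones: Fourier-Motzkin elimination and Farkas' lemma, extremal rays,
    and the fact that the normal fan of a full-dimensional rational polyhedron is
    a fan on which the support function is strictly convex
    ([normal_fan_is_fan], [normal_fan_strictly_convex]).  The second is the
    duality of nef-partitions ([nef_duality]): the polytopes [Deltas j] and
    [nablas Delta Deltas j] are cut out by the support functions of each other's
    family. *)

(* These two names also denote the Lebesgue integral and convex combination. *)
Local Notation integral := (@Defs.integral _ _).
Local Notation conv := (@Defs.conv _ _).

(** * The pairing, the lattice and the extra coordinate *)

Lemma dotC (R : realType) (n : nat) (x y : 'rV[R]_n) : dot x y = dot y x.
Proof. by apply: eq_bigr => i _; rewrite mulrC. Qed.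

Lemma dotDl (R : realType) (n : nat) (x y z : 'rV[R]_n) :
  dot (x + y) z = dot x z + dot y z.
Proof. by rewrite -big_split; apply: eq_bigr => i _; rewrite mxE mulrDl. Qed.

Lemma dotZl (R : realType) (n : nat) (c : R) (x z : 'rV[R]_n) :
  dot (c *: x) z = c * dot x z.
Proof. by rewrite mulr_sumr; apply: eq_bigr => i _; rewrite mxE mulrA. Qed.

Lemma dotDr (R : realType) (n : nat) (x y z : 'rV[R]_n) :
  dot z (x + y) = dot z x + dot z y.
Proof. by rewrite dotC dotDl !(dotC z). Qed.

Lemma dotZr (R : realType) (n : nat) (c : R) (x z : 'rV[R]_n) :
  dot z (c *: x) = c * dot z x.
Proof. by rewrite dotC dotZl dotC. Qed.

Lemma dot0l (R : realType) (n : nat) (z : 'rV[R]_n) : dot 0 z = 0.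
Proof. by rewrite -(scale0r 0) dotZl mul0r. Qed.

Lemma dot0r (R : realType) (n : nat) (z : 'rV[R]_n) : dot z 0 = 0.
Proof. by rewrite dotC dot0l. Qed.

Lemma dotNl (R : realType) (n : nat) (x z : 'rV[R]_n) : dot (- x) z = - dot x z.
Proof. by rewrite -scaleN1r dotZl mulN1r. Qed.

Lemma dotNr (R : realType) (n : nat) (x z : 'rV[R]_n) : dot z (- x) = - dot z x.
Proof. by rewrite dotC dotNl dotC. Qed.

Lemma dotBl (R : realType) (n : nat) (x y z : 'rV[R]_n) :
  dot (x - y) z = dot x z - dot y z.
Proof. by rewrite dotDl dotNl. Qed.

Lemma dot_suml (R : realType) (n : nat) (I : Type) (s : seq I) (P : pred I)
    (f : I -> 'rV[R]_n) (z : 'rV[R]_n) :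
  dot (\sum_(i <- s | P i) f i) z = \sum_(i <- s | P i) dot (f i) z.
Proof.
elim/big_rec2: _ => [|i a b _ <-]; first exact: dot0l.
by rewrite dotDl.
Qed.

Lemma dot_sumr (R : realType) (n : nat) (I : Type) (s : seq I) (P : pred I)
    (f : I -> 'rV[R]_n) (z : 'rV[R]_n) :
  dot z (\sum_(i <- s | P i) f i) = \sum_(i <- s | P i) dot z (f i).
Proof. by rewrite dotC dot_suml; apply: eq_bigr => i _; rewrite dotC. Qed.

Lemma dot_gt0 (R : realType) (n : nat) (x : 'rV[R]_n) : x != 0 -> 0 < dot x x.
Proof.
move=> x0; have [i xi] : exists i, x 0 i != 0.
  by apply/not_existsP => h; move/eqP: x0; apply; apply/rowP => i;
    rewrite mxE; have /negP/negPn/eqP := h i.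
rewrite /dot (bigD1 i) //= ltr_wpDr ?sumr_ge0 //.
  by move=> j _; rewrite -expr2 sqr_ge0.
by rewrite -expr2 exprn_even_gt0.
Qed.

Lemma dot_delta (R : realType) (n : nat) (x : 'rV[R]_n) (i : 'I_n) :
  dot x (delta_mx 0 i) = x 0 i.
Proof.
rewrite /dot (bigD1 i) //= mxE !eqxx mulr1 big1 ?addr0 // => j ji.
by rewrite mxE (negbTE ji) andbF mulr0.
Qed.

Lemma dot_pt (R : realType) (n : nat) (x y : 'rV[R]_n) (a b : R) :
  dot (pt x a) (pt y b) = dot x y + a * b.
Proof.
rewrite /dot big_split_ord /= big_ord1 /pt !row_mxEr !mxE; congr (_ + _).
by apply: eq_bigr => i _; rewrite !row_mxEl.
Qed.

Lemma pt_surj (R : realType) (n : nat) (z : 'rV[R]_(n + 1)) :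
  exists x a, z = pt x a.
Proof.
exists (lsubmx z), (rsubmx z 0 0); rewrite -[LHS]hsubmxK /pt; congr row_mx.
by apply/rowP => i; rewrite [RHS]mxE ord1.
Qed.

Lemma pt_inj (R : realType) (n : nat) (x y : 'rV[R]_n) (a b : R) :
  pt x a = pt y b -> x = y /\ a = b.
Proof.
by move=> /eq_row_mx[-> /matrixP/(_ 0 0)]; rewrite !mxE.
Qed.

Lemma ptD (R : realType) (n : nat) (x y : 'rV[R]_n) (a b : R) :
  pt x a + pt y b = pt (x + y) (a + b).
Proof.
by rewrite /pt add_row_mx; congr row_mx; apply/rowP => i; rewrite !mxE.
Qed.

Lemma ptZ (R : realType) (n : nat) (x : 'rV[R]_n) (a c : R) :
  c *: pt x a = pt (c *: x) (c * a).
Proof.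
by rewrite /pt scale_row_mx; congr row_mx; apply/rowP => i; rewrite !mxE.
Qed.

Lemma pt0 (R : realType) (n : nat) : pt 0 0 = 0 :> 'rV[R]_(n + 1).
Proof. by rewrite -(scale0r (pt 0 0)) ptZ scaler0 mul0r. Qed.

Lemma pt_sum (R : realType) (n : nat) (I : Type) (s : seq I)
    (f : I -> 'rV[R]_n) (g : I -> R) :
  \sum_(i <- s) pt (f i) (g i) = pt (\sum_(i <- s) f i) (\sum_(i <- s) g i).
Proof.
elim: s => [|i s IH]; first by rewrite !big_nil pt0.
by rewrite !big_cons IH ptD.
Qed.

Lemma lattice_dot (R : realType) (n : nat) (x y : 'rV[R]_n) :
  integral x -> integral y -> dot x y \is a Num.int.
Proof.
move=> /mxOverP ix /mxOverP iy; apply: rpred_sum => i _.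
by apply: rpredM.
Qed.

Lemma lattice0 (R : realType) (n : nat) : integral (0 : 'rV[R]_n).
Proof. by apply/mxOverP => i j; rewrite mxE. Qed.

Lemma latticeD (R : realType) (n : nat) (x y : 'rV[R]_n) :
  integral x -> integral y -> integral (x + y).
Proof.
by move=> /mxOverP ix /mxOverP iy; apply/mxOverP => i j; rewrite mxE rpredD.
Qed.

Lemma latticeZ (R : realType) (n : nat) (c : R) (x : 'rV[R]_n) :
  c \is a Num.int -> integral x -> integral (c *: x).
Proof.
by move=> ic /mxOverP ix; apply/mxOverP => i j; rewrite mxE rpredM.
Qed.

Lemma latticeN (R : realType) (n : nat) (x : 'rV[R]_n) :
  integral x -> integral (- x).
Proof. by move=> ix; rewrite -scaleN1r; apply: latticeZ; rewrite ?rpredN ?rpred1. Qed.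

Lemma lattice_sum (R : realType) (n : nat) (I : eqType) (s : seq I)
    (f : I -> 'rV[R]_n) :
  (forall i, i \in s -> integral (f i)) -> integral (\sum_(i <- s) f i).
Proof.
move=> h; rewrite big_seq; elim/big_ind: _ => //; first exact: lattice0.
exact: latticeD.
Qed.

Lemma lattice_pt (R : realType) (n : nat) (x : 'rV[R]_n) (a : R) :
  integral (pt x a) <-> integral x /\ a \is a Num.int.
Proof.
split=> [/mxOverP h|[/mxOverP ix ia]].
  split; first by apply/mxOverP => i j; have := h i (lshift 1 j); rewrite row_mxEl.
  by have := h 0 (rshift n 0); rewrite row_mxEr mxE.
apply/mxOverP => i j; rewrite mxE; case: split_ordP => k _ //.
by rewrite mxE.
Qed.

Lemma lattice_delta (R : realType) (n : nat) (i : 'I_n) :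
  integral (delta_mx 0 i : 'rV[R]_n).
Proof. by apply/mxOverP => a j; rewrite mxE rpred_nat. Qed.

Lemma ray_mem (R : realType) (n : nat) (v : 'rV[R]_n) : ray v v.
Proof. by exists 1; rewrite ?ler01 ?scale1r. Qed.

(** * Finitely generated cones *)

Definition hull (R : realType) (n : nat) (s : seq 'rV[R]_n) : set 'rV[R]_n :=
  smallest (@convex_cone R n) [set` s].

Definition halfspaces (R : realType) (n : nat) (A : seq 'rV[R]_n) :
    set 'rV[R]_n :=
  [set x | forall a, a \in A -> 0 <= dot a x].

Lemma hull_cone (R : realType) (n : nat) (s : seq 'rV[R]_n) :
  convex_cone (hull s).
Proof.
split; first by move=> C [[C0 _ _] _].
  by move=> x y hx hy C CC; have [_ CD _] := CC.1; apply: CD; [exact: hx|exact: hy].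
by move=> t x t0 hx C CC; have [_ _ CZ] := CC.1; apply: CZ => //; exact: hx.
Qed.

Lemma hull_gen (R : realType) (n : nat) (s : seq 'rV[R]_n) (v : 'rV[R]_n) :
  v \in s -> hull s v.
Proof. by move=> vs; apply: sub_gen_smallest. Qed.

Lemma hull_sub (R : realType) (n : nat) (s : seq 'rV[R]_n) (C : set 'rV[R]_n) :
  convex_cone C -> (forall v, v \in s -> C v) -> hull s `<=` C.
Proof. by move=> CC h; apply: smallest_sub. Qed.

Lemma halfspaces_cone (R : realType) (n : nat) (A : seq 'rV[R]_n) :
  convex_cone (halfspaces A).
Proof.
split=> [a _|x y hx hy a aA|t x t0 hx a aA]; first by rewrite dot0r.
  by rewrite dotDr addr_ge0 ?hx ?hy.
by rewrite dotZr mulr_ge0 ?hx.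
Qed.

Lemma cone_sum (R : realType) (n : nat) (C : set 'rV[R]_n) (I : eqType)
    (s : seq I) (f : I -> 'rV[R]_n) :
  convex_cone C -> (forall i, i \in s -> C (f i)) -> C (\sum_(i <- s) f i).
Proof.
move=> [C0 CD _] h; rewrite big_seq; elim/big_ind: _ => //.
Qed.

Lemma hull_cons (R : realType) (n : nat) (v : 'rV[R]_n) (s : seq 'rV[R]_n)
    (x : 'rV[R]_n) :
  hull (v :: s) x <-> exists t, 0 <= t /\ hull s (x - t *: v).
Proof.
have [H0 HD HZ] := hull_cone s.
have [K0 KD KZ] := hull_cone (v :: s).
split; last first.
  move=> [t [t0 h]]; rewrite -(subrK (t *: v) x); apply: KD; last first.
    by apply: KZ => //; apply: hull_gen; rewrite mem_head.
  by apply: hull_sub h => //; [exact: hull_cone|move=> w ws; apply: hull_gen;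
    rewrite inE ws orbT].
apply: (@hull_sub _ _ _ [set x | exists t, 0 <= t /\ hull s (x - t *: v)]).
- split => [|y z [t [t0 ht]] [u [u0 hu]]|c y c0 [t [t0 ht]]].
  + by exists 0; rewrite scale0r subr0.
  + exists (t + u); split; first exact: addr_ge0.
    by rewrite scalerDl opprD addrACA; apply: HD.
  + exists (c * t); split; first exact: mulr_ge0.
    by rewrite -scalerA -scalerBr; apply: HZ.
- move=> w; rewrite inE => /predU1P[->|ws].
    by exists 1; rewrite ler01 scale1r subrr.
  by exists 0; rewrite scale0r subr0; split=> //; apply: hull_gen.
Qed.

Lemma seq_max0 (R : realType) (L : seq R) :
  exists2 t : R, (0 <= t) && all (fun l => l <= t) L & (t == 0) || (t \in L).
Proof.
elim: L => [|l L [t /andP[t0 tL] h]]; first by exists 0; rewrite ?lexx ?eqxx.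
have [lt|/ltW tl] := leP l t.
  exists t; first by rewrite t0 /= lt.
  by case/orP: h => h; rewrite ?h // inE h !orbT.
exists l; last by rewrite mem_head orbT.
rewrite (le_trans t0 tl) /= lexx /=; apply/allP => x xL.
exact: (le_trans (allP tL x xL)).
Qed.

Lemma seq_argmin (R : realType) (T : eqType) (s : seq T) (f : T -> R) :
  s != [::] -> exists2 x, x \in s & forall y, y \in s -> f x <= f y.
Proof.
elim: s => // x s IH _; case: (eqVneq s [::]) => [->|/IH[y ys hy]].
  by exists x; rewrite ?mem_head // => y; rewrite inE => /eqP->.
have [xy|/ltW yx] := leP (f x) (f y).
  exists x; rewrite ?mem_head // => z; rewrite inE => /predU1P[->//|/hy].
  exact: le_trans.
exists y; rewrite ?inE ?ys ?orbT // => z.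
by rewrite inE => /predU1P[->//|/hy].
Qed.

(** Weyl's half of the Minkowski-Weyl theorem, by Fourier-Motzkin elimination:
    adding a generator [v] amounts to eliminating [t] from the inequalities of
    [x - t *: v], and every new inequality is an integral combination of two
    old ones as soon as [v] is integral. *)
Lemma hull_halfspaces (R : realType) (n : nat) (s : seq 'rV[R]_n) :
  exists A, hull s = halfspaces A /\
    ((forall v, v \in s -> integral v) -> forall a, a \in A -> integral a).
Proof.
elim: s => [|v s [A [hA iA]]].
  exists ([seq delta_mx 0 i | i <- enum 'I_n] ++ [seq - delta_mx 0 i | i <- enum 'I_n]).
  split; last first.
    move=> _ a; rewrite mem_cat => /orP[] /mapP[i _ ->];
      [|apply: latticeN]; exact: lattice_delta.
  apply/seteqP; split=> x.
    apply: hull_sub => //; exact: halfspaces_cone.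
  move=> hx; suff -> : x = 0 by have [] := @hull_cone R n [::].
  apply/rowP => i; rewrite mxE; apply/eqP; rewrite eq_le -!(dot_delta x).
  have i1 := hx (delta_mx 0 i); have i2 := hx (- delta_mx 0 i).
  rewrite dotC i1 ?andbT; first by rewrite -oppr_ge0 -dotNl i2 // mem_cat
    (map_f (fun i => - delta_mx 0 i)) ?mem_enum ?orbT.
  by rewrite mem_cat (map_f (delta_mx 0)) ?mem_enum.
pose Ap := [seq a <- A | 0 < dot a v]; pose An := [seq a <- A | dot a v < 0].
pose comb p q : 'rV[R]_n := dot p v *: q - dot q v *: p.
exists ([seq a <- A | 0 <= dot a v] ++ [seq comb p q | p <- Ap, q <- An]).
split; last first.
  move=> is_ a; have iv : integral v by apply: is_; rewrite mem_head.
  have {}iA : forall a, a \in A -> integral a.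
    by apply: iA => w ws; apply: is_; rewrite inE ws orbT.
  rewrite mem_cat mem_filter => /orP[/andP[_ /iA]//|/allpairsP[[p q]/=]].
  rewrite !mem_filter => -[/andP[_ /iA ip] /andP[_ /iA iq] ->].
  by apply: latticeD; rewrite -?scaleNr; apply: latticeZ => //; rewrite ?rpredN;
    apply: lattice_dot.
apply/seteqP; split=> x.
  move/hull_cons => [t [t0]]; rewrite hA => hx a.
  have hx' b : b \in A -> t * dot b v <= dot b x.
    by move=> bA; have := hx _ bA; rewrite dotDr dotNr dotZr subr_ge0.
  rewrite mem_cat mem_filter => /orP[/andP[av aA]|/allpairsP[[p q]/=]].
    by apply: le_trans (hx' a aA); apply: mulr_ge0.
  rewrite !mem_filter => -[/andP[pv pA] /andP[qv qA] ->].
  rewrite dotBl !dotZl; have := hx' p pA; have := hx' q qA; nra.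
move=> hx; apply/hull_cons.
have [t /andP[t0 /allP tA] tE] := seq_max0 [seq dot q x / dot q v | q <- An].
exists t; split=> //; rewrite hA => a aA; rewrite dotDr dotNr dotZr subr_ge0.
have [av|av|av] := ltrgtP (dot a v) 0.
- have aN : a \in An by rewrite mem_filter av.
  by rewrite -ler_ndivrMr //; apply: tA; apply: map_f.
- rewrite -ler_pdivlMr //; have ax : 0 <= dot a x.
    by apply: hx; rewrite mem_cat mem_filter (ltW av) aA.
  case/orP: tE => [/eqP->|/mapP[q qN ->]]; first exact: divr_ge0 (ltW av).
  have := qN; rewrite mem_filter => /andP[qv qA].
  have : 0 <= dot (comb a q) x.
    apply: hx; rewrite mem_cat; apply/orP; right; apply/allpairsP.
    by exists (a, q); rewrite /= mem_filter av aA.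
  rewrite ler_pdivlMr // mulrAC ler_ndivrMr // /comb dotBl !dotZl subr_ge0.
  by rewrite (mulrC (dot a x)) (mulrC (dot q x)).
- rewrite av mulr0; apply: hx.
  by rewrite mem_cat mem_filter av lexx aA.
Qed.

Lemma halfspaces_dual (R : realType) (n : nat) (A : seq 'rV[R]_n)
    (a x : 'rV[R]_n) : hull A a -> halfspaces A x -> 0 <= dot a x.
Proof.
move=> ha hx; move: a ha; apply: hull_sub => //.
split=> [|y z /= hy hz|t y t0 /= hy]; first by rewrite /= dot0l.
  by rewrite dotDl addr_ge0.
by rewrite dotZl mulr_ge0.
Qed.

Lemma farkas (R : realType) (n : nat) (s : seq 'rV[R]_n) (x : 'rV[R]_n) :
  ~ hull s x ->
  exists a, (forall v, v \in s -> 0 <= dot a v) /\ dot a x < 0.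
Proof.
have [A [hA _]] := hull_halfspaces s; rewrite hA => nx.
have [a aA ax] : exists2 a, a \in A & dot a x < 0.
  apply: contrapT => h; apply: nx => a aA; rewrite leNgt; apply/negP => ax.
  by apply: h; exists a.
exists a; split=> // v vs; have := hull_gen vs; rewrite hA; exact.
Qed.

(** Minkowski's half: it is Weyl's half applied to the dual cone. *)
Lemma halfspaces_hull (R : realType) (n : nat) (A : seq 'rV[R]_n) :
  exists s, halfspaces A = hull s /\
    ((forall a, a \in A -> integral a) -> forall v, v \in s -> integral v).
Proof.
have [B [hB iB]] := hull_halfspaces A; exists B; split=> //.
apply/seteqP; split; last first.
  apply: hull_sub; first exact: halfspaces_cone.
  move=> b bB a aA; have := hull_gen aA; rewrite hB => /(_ b bB).
  by rewrite dotC.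
move=> x hx; apply: contrapT => /farkas[a [ha]]; rewrite ltNge => /negP; apply.
apply: halfspaces_dual hx; rewrite hB => b bB; rewrite dotC; exact: ha.
Qed.

Lemma halfspaces_rational (R : realType) (n : nat) (A : seq 'rV[R]_n) :
  (forall a, a \in A -> integral a) -> rational_cone (halfspaces A).
Proof.
by move=> iA; have [s [-> /(_ iA) is_]] := halfspaces_hull A; exists s.
Qed.

(** * Convex hulls and extremal rays *)

Lemma conv_comb (R : realType) (n : nat) (A : set 'rV[R]_n) (x y : 'rV[R]_n)
    (t : R) :
  0 <= t <= 1 -> conv A x -> conv A y -> conv A (t *: x + (1 - t) *: y).
Proof.
move=> /andP[t0 t1] hx hy C CC; have {}hx := hx _ CC; have {}hy := hy _ CC.
by have := CC.1 x y (Itv01 t0 t1); rewrite !inE; apply.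
Qed.

Lemma conv_sub (R : realType) (n : nat) (A C : set 'rV[R]_n) :
  (forall x y t, 0 <= t <= 1 -> C x -> C y -> C (t *: x + (1 - t) *: y)) ->
  A `<=` C -> conv A `<=` C.
Proof.
move=> CC AC; apply: smallest_sub => // x y t; rewrite !inE => hx hy.
by apply: CC => //; apply/andP; split; [exact: ge0|exact: le1].
Qed.

Lemma conv_gen (R : realType) (n : nat) (A : set 'rV[R]_n) (x : 'rV[R]_n) :
  A x -> conv A x.
Proof. by move=> Ax; apply: sub_gen_smallest. Qed.

Lemma conv_dot_ge (R : realType) (n : nat) (A : set 'rV[R]_n)
    (y : 'rV[R]_n) (c : R) :
  (forall s, A s -> c <= dot s y) -> forall x, conv A x -> c <= dot x y.
Proof.
move=> h; apply: (@conv_sub _ _ _ [set x | c <= dot x y]) => // x z t.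
by move=> /andP[t0 t1] /= cx cz; rewrite dotDl !dotZl; nra.
Qed.

Lemma conv_argmin (R : realType) (n : nat) (s : seq 'rV[R]_n)
    (x y : 'rV[R]_n) :
  conv [set` s] x -> exists2 v, v \in s & dot v y <= dot x y.
Proof.
case: (eqVneq s [::]) => [->|s0] hx.
  by have : set0 x by apply: (conv_sub _ _ hx) => // z.
have [v vs hv] := seq_argmin (fun v => dot v y) s0.
by exists v => //; apply: conv_dot_ge hx => w; apply: hv.
Qed.

(** The separation theorem for polytopes is Farkas' lemma for the cone over the
    points [pt v 1]. *)
Lemma conv_separation (R : realType) (n : nat) (s : seq 'rV[R]_n)
    (x : 'rV[R]_n) :
  (forall y, exists2 v, v \in s & dot v y <= dot x y) -> conv [set` s] x.
Proof.
move=> h; have hx : hull [seq pt v 1 | v <- s] (pt x 1).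
  apply: contrapT => /farkas[z]; have [a [b ->]] := pt_surj z.
  move=> [hs hx]; have [v vs vx] := h a.
  have := hs _ (map_f _ vs); rewrite dot_pt; move: hx vx; rewrite dot_pt.
  rewrite !(dotC a); lra.
have hull_over : hull [seq pt v 1 | v <- s] `<=`
    [set z | exists y l, [/\ z = pt y l, 0 <= l, l = 0 -> y = 0 &
       0 < l -> conv [set` s] (l^-1 *: y)]].
  apply: hull_sub; last first.
    move=> _ /mapP[v vs ->]; exists v, 1; split; rewrite ?ler01 //.
      by move/eqP; rewrite oner_eq0.
    by move=> _; rewrite invr1 scale1r; apply: conv_gen.
  split=> [|_ _ [y [l [-> l0 yl hy]]] [z [k [-> k0 zk hz]]]
          |t _ t0 [y [l [-> l0 yl hy]]]].
  - by exists 0, 0; split; rewrite ?pt0 ?ltxx.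
  - exists (y + z), (l + k); split; [exact: ptD|exact: addr_ge0| |].
      by move=> lk; rewrite yl ?zk ?addr0 //; lra.
    have [l00|lp] := eqVneq l 0; first by rewrite l00 (yl l00) !add0r.
    have [k00|kp] := eqVneq k 0.
      by rewrite k00 (zk k00) !addr0 => _; apply: hy; rewrite lt_neqAle eq_sym lp.
    have {}lp : 0 < l by rewrite lt_neqAle eq_sym lp.
    have {}kp : 0 < k by rewrite lt_neqAle eq_sym kp.
    move=> lk; have -> : (l + k)^-1 *: (y + z) =
        (l / (l + k)) *: (l^-1 *: y) + (1 - l / (l + k)) *: (k^-1 *: z).
      have [l0' k0' lk0'] : [/\ l != 0, k != 0 & l + k != 0] by rewrite !gt_eqF.
      rewrite scalerDr !scalerA; congr (_ *: _ + _ *: _); field;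
        by rewrite ?l0' ?k0' ?lk0'.
    apply: conv_comb; [|exact: hy|exact: hz].
    by rewrite divr_ge0 //= ?ler_pdivrMr ?mul1r ?lerDl // ltW.
  - exists (t *: y), (t * l); split; [exact: ptZ|exact: mulr_ge0| |].
      move/eqP; rewrite mulf_eq0 => /orP[/eqP->|/eqP/yl->].
        by rewrite scale0r.
      by rewrite scaler0.
    move=> tl; have tp : t != 0 by apply: contraTneq tl => ->; rewrite mul0r ltxx.
    have lp : 0 < l by rewrite lt_neqAle l0 andbT eq_sym;
      apply: contraTneq tl => ->; rewrite mulr0 ltxx.
    by rewrite scalerA invfM mulrC mulrA mulfV // mul1r; apply: hy.
have [y [l [/pt_inj[-> <-] _ _]]] := hull_over _ hx.
by rewrite invr1 scale1r; apply.
Qed.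

Lemma hull_subset (R : realType) (n : nat) (s t : seq 'rV[R]_n) :
  {subset s <= t} -> hull s `<=` hull t.
Proof.
by move=> st; apply: hull_sub; [exact: hull_cone|move=> v /st; apply: hull_gen].
Qed.

Lemma hull_rem (R : realType) (n : nat) (v : 'rV[R]_n) (s : seq 'rV[R]_n) :
  v \in s -> hull (v :: rem v s) = hull s.
Proof.
by move=> vs; apply/seteqP; split; apply: hull_subset => w;
  rewrite (perm_mem (perm_to_rem vs)).
Qed.

Lemma hull_reduced (R : realType) (n : nat) (s : seq 'rV[R]_n) :
  exists s', [/\ hull s' = hull s, {subset s' <= s} &
    forall v, v \in s' -> v != 0 /\ ~ hull (rem v s') v].
Proof.
move: {2}(size s) (leqnn (size s)) => k; elim: k s => [|k IH] s.
  by rewrite leqn0 size_eq0 => /eqP->; exists [::].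
move=> sk; case: (pselect (forall v, v \in s -> v != 0 /\ ~ hull (rem v s) v)).
  by move=> h; exists s; split=> // w.
move=> /existsNP[v /not_implyP[vs nv]].
have hv : hull (rem v s) v.
  apply: contrapT => h; apply: nv; split=> //; apply/eqP => v0; apply: h.
  by rewrite v0; have [] := hull_cone (rem 0 s).
have [|s' [h' ss hs]] := IH (rem v s).
  by rewrite size_rem //; move: sk; case: (size s).
exists s'; split=> //; last by move=> w /ss /mem_rem.
rewrite h' -(hull_rem vs); apply/seteqP; split.
  by apply: hull_subset => w; rewrite inE orbC => ->.
apply: hull_sub; first exact: hull_cone.
by move=> w; rewrite inE => /predU1P[->//|]; apply: hull_gen.
Qed.

(** In a strongly convex cone every generator [v] of an irredundant list spans
    an exposed ray: by Farkas' lemma each other generator [w] can be separated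
    from [- w] in the cone where [v] has been made invertible, and the sum of
    the separating forms exposes [v]. *)
Lemma face_ray (R : realType) (n : nat) (s : seq 'rV[R]_n) (v : 'rV[R]_n) :
  strongly_convex (hull s) -> v \in s -> (forall w, w \in s -> w != 0) ->
  ~ hull (rem v s) v -> face (hull s) (ray v).
Proof.
move=> sc vs s0 nv; have [H0 HD HZ] := hull_cone s.
have [K0 KD KZ] := hull_cone (rem v s).
have rs : hull (rem v s) `<=` hull s by apply: hull_subset => u /mem_rem.
have sep w : w \in rem v s -> exists y, [/\ dot y v = 0,
    forall u, u \in s -> 0 <= dot y u & 0 < dot y w].
  move=> ws; have : ~ hull (- v :: s) (- w).
    move=> /hull_cons[c [c0]]; rewrite scalerN opprK => h.
    move: (h); rewrite -(hull_rem vs) => /hull_cons[d [d0 hd]].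
    have [cd|dc] := ltP d c; last first.
      have : w = 0.
        apply: sc; first by apply: hull_gen; exact: mem_rem ws.
        have -> : - w = (- w + c *: v - d *: v) + (d - c) *: v.
          by rewrite scalerBl subrKA addrK.
        by apply: HD; [exact: rs|apply: HZ; rewrite ?subr_ge0 //; apply: hull_gen].
      by apply/eqP/s0; exact: mem_rem ws.
    apply: nv; have vE : v = (c - d)^-1 *: (w + (- w + c *: v - d *: v)).
      by rewrite -!addrA addNKr -scalerBl scalerA mulVf ?scale1r //; lra.
    rewrite {2}vE.
    apply: KZ; first by rewrite invr_ge0; lra.
    by apply: KD => //; apply: hull_gen.
  move=> /farkas[y [hy yw]]; exists y; split.
  - apply/eqP; rewrite eq_le (hy v) ?inE ?vs ?orbT // andbT.
    by rewrite -oppr_ge0 -dotNr hy ?mem_head.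
  - by move=> u us; apply: hy; rewrite inE us orbT.
  - by move: yw; rewrite dotNr oppr_lt0.
have [y [yv yp]] : exists y, dot v y = 0 /\
    (forall u, u \in rem v s -> 0 < dot u y).
  suff : forall l : seq 'rV[R]_n, {subset l <= rem v s} -> exists y, [/\ dot y v = 0,
      forall u, u \in s -> 0 <= dot y u & forall u, u \in l -> 0 < dot y u].
    move=> /(_ (rem v s))[//|y [yv _ yp]].
    by exists y; rewrite dotC; split=> // u; rewrite dotC; apply: yp.
  elim=> [|w l IH] ls; first by exists 0; split=> [|u _|//]; rewrite ?dot0l.
  have [u ul|y [yv ys yp]] := IH; first by apply: ls; rewrite inE ul orbT.
  have [z [zv zs zw]] := sep w (ls _ (mem_head _ _)).
  have ws : w \in s by apply: mem_rem (ls _ (mem_head _ _)).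
  exists (y + z); split=> [|u us|u]; first by rewrite dotDl yv zv addr0.
    by rewrite dotDl addr_ge0 ?ys ?zs.
  rewrite inE dotDl => /predU1P[->|ul]; first by rewrite ltr_wpDl ?ys.
  rewrite ltr_pwDl ?yp // zs //; apply: mem_rem (ls _ _).
  by rewrite inE ul orbT.
have hull_pos : hull (rem v s) `<=` [set u | 0 <= dot u y /\ (dot u y = 0 -> u = 0)].
  apply: hull_sub; last first.
    by move=> u /yp uy; split; [exact: ltW|move=> u0; move: uy; rewrite u0 ltxx].
  split=> [|a b [a0 az] [b0 bz]|t a t0 [a0 az]]; first by rewrite /= dot0l.
    rewrite /= dotDl; split; first exact: addr_ge0.
    by move=> /eqP; rewrite paddr_eq0 // => /andP[/eqP/az-> /eqP/bz->]; rewrite addr0.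
  rewrite /= dotZl; split; first exact: mulr_ge0.
  by move=> /eqP; rewrite mulf_eq0 => /orP[/eqP->|/eqP/az->]; rewrite ?scale0r ?scaler0.
split; first by exists v; exact: ray_mem.
exists y; apply/seteqP; split=> [_ [t t0 ->]|x [hx /(_ 0 H0)]].
  split; first by apply: HZ => //; apply: hull_gen.
  move=> x'; rewrite dotZl yv mulr0 -(hull_rem vs) => /hull_cons[u [_ /hull_pos[]]].
  by rewrite dotBl dotZl yv mulr0 subr0.
move: hx; rewrite -(hull_rem vs) => /hull_cons[t [t0 /hull_pos[]]].
rewrite dotBl dotZl yv mulr0 subr0 dot0l => x0 xt x0'; exists t => //.
by apply/eqP; rewrite -subr_eq0 xt //; apply/eqP; rewrite eq_le x0' x0.
Qed.

Lemma fan_rays (R : realType) (n : nat) (F : set (set 'rV[R]_n))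
    (C : set 'rV[R]_n) :
  is_fan F -> F C -> exists s, [/\ C = hull s,
    forall v, v \in s -> integral v & forall v, v \in s -> v != 0 /\ F (ray v)].
Proof.
move=> [_ rC fC _] FC; have [[s [is_ Cs]] sc] := rC _ FC.
have [s' [h ss' hs]] := hull_reduced s; exists s'; split.
- by rewrite h.
- by move=> v /ss'; apply: is_.
move=> v vs; have [v0 nv] := hs v vs; split=> //; apply: (fC _ _ FC).
by rewrite Cs -/(hull s) -h; apply: face_ray => //; [rewrite h /hull -Cs|
  move=> w /hs[]].
Qed.

(** * Normal fans *)

Definition min_face (R : realType) (n : nat) (P : set 'rV[R]_n) (y : 'rV[R]_n) :
    set 'rV[R]_n :=
  [set x | P x /\ forall x', P x' -> dot x y <= dot x' y].

Definition ncone (R : realType) (n : nat) (P : set 'rV[R]_n) (y : 'rV[R]_n) :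
    set 'rV[R]_n :=
  normal_cone P (min_face P y).

(** This says that the closed convex hull of [P] is the polyhedron
    conv S + cone T, through support functions rather than by writing the points
    of [P] as combinations: it is all that normal fans depend on, and it passes
    to Minkowski sums at no cost. *)
Definition generated (R : realType) (n : nat) (P : set 'rV[R]_n)
    (S T : seq 'rV[R]_n) : Prop :=
  [/\ S != [::], forall s, s \in S -> P s,
      forall x t c, P x -> t \in T -> 0 <= c -> P (x + c *: t)
    & forall y, halfspaces T y -> forall x, P x ->
        exists2 s, s \in S & dot s y <= dot x y].

Lemma min_faceE (R : realType) (n : nat) (P : set 'rV[R]_n) (y x z : 'rV[R]_n) :
  min_face P y x -> min_face P y z -> dot x y = dot z y.
Proof.
by move=> [Px hx] [Pz hz]; apply/eqP; rewrite eq_le hx ?hz.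
Qed.

Lemma min_face_le (R : realType) (n : nat) (P : set 'rV[R]_n) (y x z : 'rV[R]_n) :
  min_face P y x -> P z -> dot z y <= dot x y -> min_face P y z.
Proof.
by move=> [Px hx] Pz zx; split=> // w /hx; apply: le_trans.
Qed.

Lemma ncone_refl (R : realType) (n : nat) (P : set 'rV[R]_n) (y : 'rV[R]_n) :
  ncone P y y.
Proof. by move=> x x' [_]; apply. Qed.

Lemma support_fun_min (R : realType) (n : nat) (P : set 'rV[R]_n)
    (y x : 'rV[R]_n) : min_face P y x -> support_fun P y = - dot x y.
Proof.
move=> [Px hx]; congr (- _); apply/eqP; rewrite eq_le; apply/andP; split.
  apply: ge_inf; last by exists x.
  by exists (dot x y) => _ [z Pz <-]; apply: hx.
by apply: lb_le_inf; [exists (dot x y), x|move=> _ [z Pz <-]; apply: hx].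
Qed.

(** A small step from a point of a polyhedral cone in a direction that does not
    leave its tight inequalities stays in the cone. *)
Lemma seq_small_step (R : realType) (I : eqType) (l : seq I) (a b : I -> R) :
  (forall i, i \in l -> 0 <= a i /\ (a i = 0 -> b i <= 0)) ->
  exists2 e : R, 0 < e & forall i, i \in l -> e * b i <= a i.
Proof.
elim: l => [|i l IH] h; first by exists 1.
have [j jl|e e0 he] := IH; first by apply: h; rewrite inE jl orbT.
have [a0 ab] := h i (mem_head _ _).
have [b0|b0] := leP (b i) 0.
  exists e => // j; rewrite inE => /predU1P[->|/he//].
  by apply: le_trans a0; rewrite mulr_ge0_le0 // ltW.
have ap : 0 < a i.
  by rewrite lt_neqAle a0 andbT; apply: contraTneq b0 => /esym/ab; rewrite ltNge => ->.
have d0 : 0 < Num.min e (a i / b i) by rewrite lt_min e0 divr_gt0.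
exists (Num.min e (a i / b i)) => // j; rewrite inE => /predU1P[->|jl].
  by rewrite -ler_pdivlMr // ge_min lexx orbT.
have [bj|bj] := leP (b j) 0.
  apply: le_trans (_ : 0 <= _); first by rewrite mulr_ge0_le0 // ltW.
  by have [] := h j; rewrite ?inE ?jl ?orbT.
by apply: le_trans (he j jl); rewrite ler_wpM2r ?(ltW bj) // ge_min lexx.
Qed.

Lemma gen_argmin (R : realType) (n : nat) (P : set 'rV[R]_n)
    (S T : seq 'rV[R]_n) (y : 'rV[R]_n) :
  generated P S T -> halfspaces T y -> exists2 s, s \in S & min_face P y s.
Proof.
move=> [S0 SP PT hS] Ty; have [s sS hs] := seq_argmin (fun s => dot s y) S0.
exists s => //; split; first exact: SP.
by move=> x /(hS y Ty)[s' s'S]; apply: le_trans; apply: hs.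
Qed.

Lemma gen_min_face (R : realType) (n : nat) (P : set 'rV[R]_n)
    (S T : seq 'rV[R]_n) (y s : 'rV[R]_n) :
  generated P S T -> halfspaces T y -> s \in S ->
  (forall s', s' \in S -> dot s y <= dot s' y) -> min_face P y s.
Proof.
move=> [S0 SP PT hS] Ty sS hs; split; first exact: SP.
by move=> x /(hS y Ty)[s' s'S]; apply: le_trans; apply: hs.
Qed.

Lemma gen_halfspaces (R : realType) (n : nat) (P : set 'rV[R]_n)
    (S T : seq 'rV[R]_n) (y x : 'rV[R]_n) :
  generated P S T -> min_face P y x -> halfspaces T y.
Proof.
move=> [S0 SP PT hS] [Px hx] t tT.
have := hx _ (PT x t 1 Px tT ler01); rewrite scale1r dotDl; lra.
Qed.

Lemma normal_fanE (R : realType) (n : nat) (P : set 'rV[R]_n)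
    (S T : seq 'rV[R]_n) (C : set 'rV[R]_n) : generated P S T ->
  normal_fan P C <-> exists y, halfspaces T y /\ C = ncone P y.
Proof.
move=> gP; split=> [[F [[x Fx] [y Fy]] <-]|[y [Ty ->]]].
  exists y; rewrite /ncone -/(min_face P y) in Fy *; rewrite Fy; split=> //.
  by move: Fx; rewrite Fy; apply: gen_halfspaces gP.
exists (min_face P y) => //; split; last by exists y.
by have [s _ ys] := gen_argmin gP Ty; exists s.
Qed.

(** When the conditions hold, [y - e *: z] still attains its minimum at the
    generators that are minimal for [y], if [e] is small; comparing with a point
    of [min_face P y] shows that [z] is minimal there too. *)
Lemma nconeP (R : realType) (n : nat) (P : set 'rV[R]_n)
    (S T : seq 'rV[R]_n) (y z : 'rV[R]_n) :
  generated P S T -> halfspaces T y -> ncone P y z <->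
  [/\ halfspaces T z,
      forall s, s \in S -> min_face P y s -> min_face P z s
    & forall t, t \in T -> dot t y = 0 -> dot t z = 0].
Proof.
move=> gP Ty; have [S0 SP PT hS] := gP; have [s0 s0S ys0] := gen_argmin gP Ty.
split=> [yz|[Tz Sz T0z]].
  have zs s : min_face P y s -> min_face P z s.
    by move=> ys; split; [exact: ys.1|move=> x' Px'; apply: yz].
  split=> [|s _|t tT ty]; [exact: gen_halfspaces gP (zs _ ys0)|exact: zs|].
  have Tz := gen_halfspaces gP (zs _ ys0).
  have s0t : P (s0 + 1 *: t) by apply: PT => //; apply: SP.
  apply/eqP; rewrite eq_le Tz // andbT.
  have : min_face P y (s0 + 1 *: t).
    by apply: min_face_le ys0 s0t _; rewrite scale1r dotDl ty addr0.
  by move/zs => [_ /(_ _ ys0.1)]; rewrite scale1r dotDl gerDl.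
move=> x x' yx Px'; apply: le_trans ((Sz _ s0S ys0).2 _ Px').
have [e e0 he] : exists2 e : R, 0 < e &
    forall v, v \in T ++ [seq s - s0 | s <- S] -> e * dot v z <= dot v y.
  apply: seq_small_step => v; rewrite mem_cat => /orP[vT|/mapP[s sS ->]].
    by split=> [|v0]; [exact: Ty|rewrite T0z].
  rewrite !dotBl; split=> [|s00]; first by rewrite subr_ge0; apply: ys0.2; exact: SP.
  rewrite subr_le0; apply: (Sz s sS _).2 => //; last exact: SP.
  by apply: min_face_le ys0 (SP _ sS) _; lra.
have Tye : halfspaces T (y - e *: z).
  move=> t tT; rewrite dotDr dotNr dotZr subr_ge0; apply: he.
  by rewrite mem_cat tT.
have [s sS] := hS _ Tye _ yx.1; rewrite !(dotDr, dotNr, dotZr).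
have := he (s - s0); rewrite mem_cat (map_f (fun s => s - s0)) ?orbT // => /(_ isT).
rewrite !dotBl (min_faceE yx ys0) -subr_ge0 => h1 h2.
have : 0 <= e * (dot s0 z - dot x z) by lra.
by rewrite pmulr_rge0 // subr_ge0.
Qed.

Lemma ncone_trans (R : realType) (n : nat) (P : set 'rV[R]_n)
    (S T : seq 'rV[R]_n) (y z : 'rV[R]_n) :
  generated P S T -> halfspaces T y -> ncone P y z -> ncone P z `<=` ncone P y.
Proof.
move=> gP Ty /(nconeP _ gP Ty)[Tz Sz T0z] x /(nconeP _ gP Tz)[Tx Sx T0x].
apply/(nconeP _ gP Ty); split=> // [s sS /(Sz s sS)/(Sx s sS)//|t tT /T0z-/(_ tT)].
exact: T0x.
Qed.

Definition ncone_ineqs (R : realType) (n : nat) (S T S0 T0 : seq 'rV[R]_n) :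
    seq 'rV[R]_n :=
  T ++ [seq - t | t <- T0] ++ [seq s' - s | s <- S0, s' <- S].

Lemma ncone_halfspaces (R : realType) (n : nat) (P : set 'rV[R]_n)
    (S T : seq 'rV[R]_n) (y : 'rV[R]_n) :
  generated P S T -> halfspaces T y ->
  ncone P y = halfspaces (ncone_ineqs S T
    [seq s <- S | `[< min_face P y s >]] [seq t <- T | dot t y == 0]).
Proof.
move=> gP Ty; have [S0 SP PT hS] := gP; apply/seteqP; split=> z.
  move=> /(nconeP _ gP Ty)[Tz Sz T0z] a; rewrite !mem_cat => /or3P[/Tz//| |].
    move=> /mapP[t]; rewrite mem_filter => /andP[/eqP ty tT] ->.
    by rewrite dotNl T0z ?oppr0.
  move=> /allpairsP[[s s']/=]; rewrite mem_filter => -[/andP[/asboolP ys sS] s'S ->].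
  by rewrite dotBl subr_ge0; apply: (Sz s sS ys).2; apply: SP.
move=> hz; have Tz : halfspaces T z by move=> t tT; apply: hz; rewrite mem_cat tT.
apply/(nconeP _ gP Ty); split=> // [s sS ys|t tT ty].
  apply: (gen_min_face gP Tz sS) => s' s'S.
  rewrite -subr_ge0 -dotBl; apply: hz; rewrite !mem_cat.
  apply/or3P; apply: Or33; apply/allpairsP; exists (s, s').
  by rewrite mem_filter /= sS s'S; split=> //; rewrite andbT; apply/asboolP.
apply/eqP; rewrite eq_le Tz // andbT -oppr_ge0 -dotNl; apply: hz.
by rewrite !mem_cat (map_f (@GRing.opp _)) ?orbT // mem_filter ty eqxx.
Qed.

Lemma ncone_cone (R : realType) (n : nat) (P : set 'rV[R]_n)
    (S T : seq 'rV[R]_n) (y : 'rV[R]_n) :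
  generated P S T -> halfspaces T y -> convex_cone (ncone P y).
Proof.
by move=> gP Ty; rewrite (ncone_halfspaces gP Ty); apply: halfspaces_cone.
Qed.

Lemma cone_faceP (R : realType) (n : nat) (C F : set 'rV[R]_n) :
  convex_cone C -> face C F -> exists w, (forall x, C x -> 0 <= dot x w) /\
    F = [set x | C x /\ dot x w = 0].
Proof.
move=> [C0 CD CZ] [[d Fd] [w Fw]]; move: (Fd); rewrite Fw => -[Cd hd].
have d0 : dot d w = 0.
  have := hd _ C0; have := hd _ (CD _ _ Cd Cd); rewrite dot0l dotDl; lra.
exists w; split=> [x /hd|]; first by rewrite d0.
apply/seteqP; split=> x [Cx hx]; split=> //.
  by apply/eqP; rewrite eq_le -{2}d0 hd // andbT -[leRHS]d0 hx.
by move=> x' /hd; rewrite d0 hx.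
Qed.

(** The sum [z] of generators of a face of a normal cone is in its relative
    interior, and the face is the normal cone of [z]. *)
Lemma face_ncone (R : realType) (n : nat) (P : set 'rV[R]_n)
    (S T : seq 'rV[R]_n) (y : 'rV[R]_n) (F : set 'rV[R]_n) :
  generated P S T -> halfspaces T y -> face (ncone P y) F ->
  exists z, ncone P y z /\ F = ncone P z.
Proof.
move=> gP Ty fF; have [S0 SP PT hS] := gP; have CC := ncone_cone gP Ty.
have [w [w0 ->]] := cone_faceP CC fF.
have EL := ncone_halfspaces gP Ty; set L := ncone_ineqs _ _ _ _ in EL.
have [g [Fg _]] := halfspaces_hull (- w :: L).
have {Fg}Fg : [set x | ncone P y x /\ dot x w = 0] = hull g.
  rewrite -Fg EL; apply/seteqP; split=> x.
    move=> [hx xw] a; rewrite inE => /predU1P[->|/hx//].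
    by rewrite dotNl dotC xw oppr0.
  move=> hx; have Lx : halfspaces L x by move=> a aL; apply: hx; rewrite inE aL orbT.
  split=> //; apply/eqP; rewrite eq_le w0 ?EL // andbT.
  by rewrite -oppr_ge0 -dotNr dotC hx ?mem_head.
have gC v : v \in g -> ncone P y v by move/hull_gen; rewrite -Fg => -[].
set z := \sum_(v <- g) v.
have [yz zw] : ncone P y z /\ dot z w = 0.
  have : hull g z by apply: cone_sum; [exact: hull_cone|move=> v; apply: hull_gen].
  by rewrite -Fg.
have [Tz Sz T0z] := (nconeP _ gP Ty).1 yz.
exists z; split=> //; rewrite Fg; apply/seteqP; split.
  apply: hull_sub; first exact: ncone_cone gP Tz.
  move=> v vg; have [Tv Sv T0v] := (nconeP _ gP Ty).1 (gC v vg).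
  have [s0 s0S ys0] := gen_argmin gP Ty.
  apply/(nconeP _ gP Tz); split=> // [s sS zs|t tT tz].
    have h : \sum_(v <- g) dot (s - s0) v = 0.
      rewrite -dot_sumr -/z dotBl (min_faceE zs (Sz _ s0S ys0)) subrr //.
    apply: min_face_le (Sv _ s0S ys0) (SP _ sS) _.
    rewrite -subr_le0 -dotBl -h big_seq (big_rem v vg) /= vg lerDl big_seq_cond.
    apply: sumr_ge0 => u /andP[_ ug]; rewrite dotBl subr_ge0.
    have [_ Su _] := (nconeP _ gP Ty).1 (gC u ug).
    exact: (Su _ s0S ys0).2 _ (SP _ sS).
  apply/eqP; rewrite eq_le Tv // andbT -tz /z dot_sumr (big_rem v vg) /= lerDl.
  rewrite big_seq; apply: sumr_ge0 => u /mem_rem ug.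
  by have [Tu _ _] := (nconeP _ gP Ty).1 (gC u ug); apply: Tu.
move=> x zx; rewrite -Fg; have yx := ncone_trans gP Ty yz zx.
have [Tx Sx T0x] := (nconeP _ gP Tz).1 zx.
split=> //; apply/eqP; rewrite eq_le w0 // andbT.
have [e e0 he] : exists2 e : R, 0 < e & forall l, l \in L -> e * dot l x <= dot l z.
  apply: seq_small_step => l lL; split; first by move: yz; rewrite EL; apply.
  move: lL; rewrite !mem_cat => /or3P[lT /T0x->//| |].
    move=> /mapP[t]; rewrite mem_filter => /andP[/eqP ty tT] -> _.
    by rewrite dotNl T0x ?oppr0 // T0z.
  move=> /allpairsP[[s s']/=]; rewrite mem_filter => -[/andP[/asboolP ys sS] s'S ->].
  rewrite !dotBl subr_le0 => ss'; apply: (Sx s' s'S _).2; last exact: SP.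
  by apply: min_face_le (Sz s sS ys) (SP _ s'S) _; lra.
have : ncone P y (z - e *: x).
  by rewrite EL => l lL; rewrite dotDr dotNr dotZr subr_ge0 he.
move/w0; rewrite dotBl dotZl zw sub0r oppr_ge0 pmulr_rle0 //.
Qed.

Lemma sumr_le0_mem (R : realType) (I : eqType) (l : seq I) (f : I -> R) :
  (forall i, i \in l -> 0 <= f i) -> \sum_(i <- l) f i <= 0 ->
  forall i, i \in l -> f i = 0.
Proof.
move=> f0 s0 i il; apply/eqP; rewrite eq_le f0 // andbT; apply: le_trans s0.
rewrite (big_rem i il) /= lerDl big_seq; apply: sumr_ge0 => j /mem_rem.
exact: f0.
Qed.

Lemma ncone_inter_face (R : realType) (n : nat) (P : set 'rV[R]_n)
    (S T : seq 'rV[R]_n) (y z : 'rV[R]_n) :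
  generated P S T -> halfspaces T y -> halfspaces T z ->
  face (ncone P y) (ncone P y `&` ncone P z).
Proof.
move=> gP Ty Tz; have [S0 SP PT hS] := gP.
have [C0 _ _] := ncone_cone gP Ty; have [D0 _ _] := ncone_cone gP Tz.
split; first by exists 0.
have [s0 s0S ys0] := gen_argmin gP Ty.
(* the sum of all the linear forms that become tight on the second cone *)
pose l := [seq s - s0 | s <- [seq s <- S | `[< min_face P z s >]]] ++
          [seq t <- T | dot t z == 0].
have l0 x : ncone P y x -> forall v, v \in l -> 0 <= dot v x.
  move=> /(nconeP _ gP Ty)[Tx Sx _] v; rewrite mem_cat => /orP[/mapP[s]|].
    rewrite mem_filter => /andP[_ sS] ->; rewrite dotBl subr_ge0.
    by apply: (Sx _ s0S ys0).2; apply: SP.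
  by rewrite mem_filter => /andP[_]; apply: Tx.
exists (\sum_(v <- l) v); apply/seteqP; split=> x [yx].
  move=> /(nconeP _ gP Tz)[_ zx T0x]; split=> // x' yx'.
  apply: le_trans (_ : 0 <= _); last first.
    by rewrite dotC dot_suml big_seq; apply: sumr_ge0 => v /l0; apply.
  rewrite dotC dot_suml big_seq; apply: sumr_le0 => v.
  rewrite mem_cat => /orP[/mapP[s]|]; rewrite mem_filter.
    move=> /andP[/asboolP zs sS] ->; rewrite dotBl subr_le0.
    by apply: (zx s sS zs).2; apply: SP.
  by move=> /andP[/eqP tz tT]; rewrite T0x.
move=> /(_ _ C0); rewrite dotC dot_suml dot0l => h.
have {h} vx v : v \in l -> dot v x = 0.
  by move: v; apply: sumr_le0_mem h; apply: l0.
split=> //; have [Tx Sx T0x] := (nconeP _ gP Ty).1 yx.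
apply/(nconeP _ gP Tz); split=> // [s sS zs|t tT tz].
  apply: min_face_le (Sx _ s0S ys0) (SP _ sS) _.
  rewrite -subr_le0 -dotBl vx // mem_cat (map_f (fun s => s - s0)) //.
  by rewrite mem_filter sS andbT; apply/asboolP.
by apply: vx; rewrite mem_cat mem_filter tz eqxx tT orbT.
Qed.

Lemma normal_fan_finite (R : realType) (n : nat) (P : set 'rV[R]_n)
    (S T : seq 'rV[R]_n) : generated P S T -> finite_set (normal_fan P).
Proof.
move=> gP; pose f (m : (size S).-tuple bool * (size T).-tuple bool) :=
  halfspaces (ncone_ineqs S T (mask m.1 S) (mask m.2 T)).
apply: (@sub_finite_set _ _ (range f)); last exact/finite_image/finite_finset.
move=> C /(normal_fanE _ gP)[y [Ty ->]]; rewrite (ncone_halfspaces gP Ty).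
exists ([tuple of map (fun s => `[< min_face P y s >]) (in_tuple S)],
        [tuple of map (fun t => dot t y == 0) (in_tuple T)]) => //.
by rewrite /f /= !filter_mask.
Qed.

Lemma normal_fan_is_fan (R : realType) (n : nat) (P : set 'rV[R]_n)
    (S T : seq 'rV[R]_n) :
  generated P S T ->
  (forall s, s \in S -> integral s) -> (forall t, t \in T -> integral t) ->
  (forall y, halfspaces T y -> halfspaces T (- y) ->
     (forall s s', s \in S -> s' \in S -> dot s y <= dot s' y) -> y = 0) ->
  is_fan (normal_fan P).
Proof.
move=> gP iS iT full; have [S0 SP _ _] := gP.
split=> [|C /(normal_fanE _ gP)[y [Ty ->]]
         |C D /(normal_fanE _ gP)[y [Ty ->]] /(face_ncone gP Ty)[z [yz ->]]
         |C D /(normal_fanE _ gP)[y [Ty ->]] /(normal_fanE _ gP)[z [Tz ->]]].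
- exact: normal_fan_finite gP.
- split.
    rewrite (ncone_halfspaces gP Ty); apply: halfspaces_rational => a.
    rewrite !mem_cat => /or3P[/iT//|/mapP[t]|/allpairsP[[s s']/=]].
      by rewrite mem_filter => /andP[_ /iT it] ->; apply: latticeN.
    rewrite mem_filter => -[/andP[_ /iS is1] /iS is2 ->].
    by apply: latticeD => //; apply: latticeN.
  move=> z /(nconeP _ gP Ty)[Tz Sz _] /(nconeP _ gP Ty)[Tz' Sz' _].
  apply: full => // s s' sS s'S; have [s0 s0S ys0] := gen_argmin gP Ty.
  have := (Sz _ s0S ys0).2 _ (SP _ s'S); have := (Sz' _ s0S ys0).2 _ (SP _ sS).
  rewrite !dotNr; lra.
- apply/(normal_fanE _ gP); exists z; split=> //.
  by have [] := (nconeP _ gP Ty).1 yz.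
- exact: ncone_inter_face gP Ty Tz.
Qed.

Lemma normal_fan_support (R : realType) (n : nat) (P : set 'rV[R]_n)
    (S T : seq 'rV[R]_n) :
  generated P S T -> fan_support (normal_fan P) = halfspaces T.
Proof.
move=> gP; apply/seteqP; split=> [z [C /(normal_fanE _ gP)[y [Ty ->]]]|y Ty].
  by move=> /(nconeP _ gP Ty)[].
by exists (ncone P y); [apply/(normal_fanE _ gP); exists y|apply: ncone_refl].
Qed.

Lemma support_fun_ge (R : realType) (n : nat) (P : set 'rV[R]_n)
    (S T : seq 'rV[R]_n) (y x : 'rV[R]_n) :
  generated P S T -> halfspaces T y -> P x -> - dot x y <= support_fun P y.
Proof.
move=> gP Ty Px; have [s _ ys] := gen_argmin gP Ty.
by rewrite (support_fun_min ys) lerN2; apply: ys.2.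
Qed.

Lemma support_fun_linear (R : realType) (n : nat) (P : set 'rV[R]_n)
    (S T : seq 'rV[R]_n) (y : 'rV[R]_n) :
  generated P S T -> halfspaces T y -> linear_on (ncone P y) (support_fun P).
Proof.
move=> gP Ty; have [s sS ys] := gen_argmin gP Ty; exists (- s) => z.
by move=> /(nconeP _ gP Ty)[_ Sz _]; rewrite (support_fun_min (Sz _ sS ys)) dotNl.
Qed.

Lemma support_fun_lattice (R : realType) (n : nat) (P : set 'rV[R]_n)
    (S T : seq 'rV[R]_n) (y : 'rV[R]_n) :
  generated P S T -> (forall s, s \in S -> integral s) -> halfspaces T y ->
  integral y -> support_fun P y \is a Num.int.
Proof.
move=> gP iS Ty iy; have [s sS ys] := gen_argmin gP Ty.
by rewrite (support_fun_min ys) rpredN; apply: lattice_dot => //; apply: iS.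
Qed.

Lemma support_funD (R : realType) (n : nat) (P : set 'rV[R]_n)
    (S T : seq 'rV[R]_n) :
  generated P S T -> convex_on (halfspaces T) (support_fun P).
Proof.
move=> gP y z Ty Tz; have [_ TD _] := halfspaces_cone T.
have [s sS yzs] := gen_argmin gP (TD _ _ Ty Tz); rewrite (support_fun_min yzs).
have := support_fun_ge gP Ty yzs.1; have := support_fun_ge gP Tz yzs.1.
rewrite dotDr; lra.
Qed.

Lemma sub_in_count (A : eqType) (l : seq A) (p q : pred A) :
  {in l, forall a, p a -> q a} -> (count p l <= count q l)%N.
Proof.
elim: l => //= a l IH h; apply: leq_add; last first.
  by apply: IH => b bl; apply: h; rewrite inE bl orbT.
by have := h a (mem_head _ _); case: (p a) => // ->.
Qed.

Lemma count_inj (A : eqType) (l : seq A) (p q : pred A) :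
  {in l, forall a, p a -> q a} -> (count q l <= count p l)%N ->
  {in l, forall a, q a -> p a}.
Proof.
elim: l => // a l IH pq /= h.
have pql : {in l, forall a, p a -> q a} by move=> b bl; apply: pq; rewrite inE bl orbT.
have cl : (count p l <= count q l)%N by apply: sub_in_count.
have pqa := pq a (mem_head _ _).
move=> b; rewrite inE => /predU1P[->|bl].
  by move=> qa; case: (p a) h => //; rewrite qa ltnNge add0n cl.
apply: IH => //; move: h; case: (p a) pqa => [->//|_].
by case: (q a) => //; rewrite add0n => /ltnW.
Qed.

(** A cone on which the support function is additive lies in a single normal
    cone: the tight vertices and directions of [y + z] are those common to [y]
    and [z], so that a point of the cone with the fewest of them has only tight
    ones that are tight on the whole cone. *)
Lemma linearity_domain_sub (R : realType) (n : nat) (P : set 'rV[R]_n)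
    (S T : seq 'rV[R]_n) (E : set 'rV[R]_n) :
  generated P S T -> linearity_domain (halfspaces T) (support_fun P) E ->
  exists y, halfspaces T y /\ E `<=` ncone P y.
Proof.
move=> gP [[E0 ED EZ] ET [m Em]]; have [_ SP _ _] := gP.
pose k y := (count (fun s => `[< min_face P y s >]) S +
             count (fun t => (dot t y == 0)%R) T)%N.
have exk : exists i, `[< exists2 y, E y & k y = i >].
  by exists (k 0); apply/asboolP; exists 0.
case: (ex_minnP exk) => i /asboolP[y Ey <-] kmin.
exists y; split=> [|z Ez]; first exact: ET.
have [Ty Tz Tyz] : [/\ halfspaces T y, halfspaces T z & halfspaces T (y + z)].
  by split; apply: ET => //; apply: ED.
have tight s : min_face P (y + z) s -> min_face P y s /\ min_face P z s.
  move=> yzs; have := Em _ (ED _ _ Ey Ez); rewrite (support_fun_min yzs).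
  rewrite !dotDr -!Em // => h.
  have [u _ yu] := gen_argmin gP Ty; have [v _ zv] := gen_argmin gP Tz.
  move: h; rewrite (support_fun_min yu) (support_fun_min zv) => h.
  have := yu.2 _ yzs.1; have := zv.2 _ yzs.1 => h1 h2.
  by split; [apply: min_face_le yu yzs.1 _|apply: min_face_le zv yzs.1 _]; lra.
have tight0 t : t \in T -> dot t (y + z) == 0 -> dot t y == 0 /\ dot t z = 0.
  by move=> tT; rewrite dotDr paddr_eq0 ?Ty ?Tz // => /andP[-> /eqP].
have [s0 s0S yzs0] := gen_argmin gP Tyz.
have le1 : {in S, forall s, `[< min_face P (y + z) s >] -> `[< min_face P y s >]}.
  by move=> s sS /asboolP/tight[ys _]; apply/asboolP.
have le2 : {in T, forall t, dot t (y + z) == 0 -> dot t y == 0}.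
  by move=> t tT /(tight0 t tT)[].
have kyz : (k y <= k (y + z)%R)%N.
  by apply: kmin; apply/asboolP; exists (y + z) => //; apply: ED.
have c1 : (count (fun s => `[< min_face P (y + z)%R s >]) S <=
           count (fun s => `[< min_face P y s >]) S)%N by apply: sub_in_count.
have c2 : (count (fun t => (dot t (y + z) == 0)%R) T <=
           count (fun t => (dot t y == 0)%R) T)%N by apply: sub_in_count.
apply/(nconeP _ gP Ty); split=> // [s sS ys|t tT ty].
  have : `[< min_face P (y + z) s >].
    apply: (count_inj le1) => //; last exact/asboolP.
    rewrite -(leq_add2r (count (fun t => (dot t y == 0)%R) T)).
    by apply: leq_trans kyz _; rewrite leq_add2l.
  by move=> /asboolP/tight[].
apply: (tight0 t tT _).2; apply: (count_inj le2) => //; last exact/eqP.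
rewrite -(leq_add2l (count (fun s => `[< min_face P y s >]) S)).
by apply: leq_trans kyz _; rewrite leq_add2r.
Qed.

Lemma maximal_sets_cofinal (T : Type) (F G : set (set T)) :
  F `<=` G -> (forall E, G E -> exists2 C, F C & E `<=` C) ->
  maximal_sets F = maximal_sets G.
Proof.
move=> FG GF; apply/seteqP; split=> [C [FC hC]|E [GE hE]].
  split=> [|D GD CD]; first exact: FG.
  have [D' FD' DD'] := GF D GD; have D'C := hC _ FD' (subset_trans CD DD').
  by apply/seteqP; split=> //; rewrite -D'C.
have [C FC EC] := GF E GE; have CE := hE _ (FG _ FC) EC; rewrite -CE in hE *.
by split=> // D /FG; apply: hE.
Qed.

Lemma normal_fan_strictly_convex (R : realType) (n : nat) (P : set 'rV[R]_n)
    (S T : seq 'rV[R]_n) :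
  generated P S T -> strictly_convex (normal_fan P) (support_fun P).
Proof.
move=> gP; rewrite /strictly_convex (normal_fan_support gP); split.
  exact: support_funD gP.
apply: maximal_sets_cofinal => [C /(normal_fanE _ gP)[y [Ty ->]]|E].
  split; [exact: ncone_cone gP Ty| |exact: support_fun_linear gP Ty].
  by move=> z /(nconeP _ gP Ty)[].
move=> /(linearity_domain_sub gP)[y [Ty Ey]]; exists (ncone P y) => //.
by apply/(normal_fanE _ gP); exists y.
Qed.

Lemma ncone_summand (R : realType) (n : nat) (P Q : set 'rV[R]_n)
    (y : 'rV[R]_n) :
  (forall x x', min_face Q y x -> Q x' ->
     exists q, min_face P y (x + q) /\ P (x' + q)) ->
  ncone P y `<=` ncone Q y.
Proof.
move=> h z yz x x' yx Qx'; have [q [yxq Pq]] := h x x' yx Qx'.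
by have := yz _ _ yxq Pq; rewrite !dotDl lerD2r.
Qed.

Lemma fan_maximal (T : choiceType) (F : set (set T)) (C : set T) :
  finite_set F -> F C -> exists2 M, maximal_sets F M & C `<=` M.
Proof.
move=> /finite_seqP[l ->] Cl.
have Ccnt : exists k, `[< exists M, [/\ M \in l, C `<=` M &
    count (fun D => `[< M `<=` D >]) l = k] >].
  by exists (count (fun D => `[< C `<=` D >]) l); apply/asboolP; exists C; split.
case: (ex_minnP Ccnt) => k /asboolP[M [Ml CM <-]] kmin; exists M => //.
split=> // D Dl MD.
have kMD : (count (fun E => `[< M `<=` E >]) l <=
            count (fun E => `[< D `<=` E >]) l)%N.
  apply: kmin; apply/asboolP; exists D; split=> //. exact: subset_trans CM MD.
apply/seteqP; split=> //; apply/asboolP.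
apply: (count_inj _ kMD) => [E _ /asboolP DE||]; [|exact: Ml|apply/asboolP; exact: subset_refl].
by apply/asboolP; exact: subset_trans MD DE.
Qed.

(** A fan is determined by its maximal cones: the others are their faces. *)
Lemma fan_eq_maximal (R : realType) (n : nat) (F G : set (set 'rV[R]_n)) :
  is_fan F -> is_fan G -> maximal_sets F = maximal_sets G -> F = G.
Proof.
suff sub (A B : set (set 'rV[R]_n)) : is_fan A -> is_fan B ->
    maximal_sets A = maximal_sets B -> A `<=` B.
  by move=> fF fG FG; apply/seteqP; split; apply: sub.
move=> [finA _ _ interA] [_ _ faceB _] AB C AC.
have [M maxM CM] := fan_maximal finA AC.
have [BM _] : maximal_sets B M by rewrite -AB.
apply: (faceB M) => //; have := interA M C maxM.1 AC.
by rewrite (setIidr CM).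
Qed.

(** * Minkowski sums *)

Lemma choice_sums (R : realType) (n r : nat) (S_ : 'I_r -> seq 'rV[R]_n) :
  exists S : seq 'rV[R]_n, forall x, x \in S <->
    exists f : 'I_r -> 'rV[R]_n, (forall i, f i \in S_ i) /\ x = \sum_i f i.
Proof.
pose U := flatten [seq S_ i | i <- enum 'I_r].
exists [seq \sum_i val (f i) | f : {ffun 'I_r -> seq_sub U}
          in [pred f : {ffun 'I_r -> seq_sub U} | [forall i, val (f i) \in S_ i]]].
move=> x; split.
  move=> /fintype.imageP[f]; rewrite inE => /forallP hf ->.
  by exists (fun i => val (f i)).
move=> [f [hf ->]]; have fU i : f i \in U.
  by apply/flattenP; exists (S_ i) => //; apply/map_f; rewrite mem_enum.
apply/fintype.imageP; exists [ffun i => SeqSub (fU i)].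
  by rewrite inE; apply/forallP => i; rewrite ffunE /=.
by apply: eq_bigr => i _; rewrite ffunE.
Qed.

Lemma min_face_minkowski (R : realType) (n r : nat) (P : 'I_r -> set 'rV[R]_n)
    (y : 'rV[R]_n) (f : 'I_r -> 'rV[R]_n) :
  (forall i, min_face (P i) y (f i)) ->
  min_face (minkowski_sum P) y (\sum_i f i).
Proof.
move=> hf; split; first by exists f; split=> // i; have [] := hf i.
move=> _ [g [Pg ->]]; rewrite !dot_suml; apply: ler_sum => i _.
exact: (hf i).2.
Qed.

Lemma support_fun_minkowski (R : realType) (n r : nat)
    (P : 'I_r -> set 'rV[R]_n) (y : 'rV[R]_n) :
  (forall i, exists x, min_face (P i) y x) ->
  support_fun (minkowski_sum P) y = \sum_i support_fun (P i) y.
Proof.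
move=> /choice[f hf]; rewrite (support_fun_min (min_face_minkowski hf)).
rewrite dot_suml -sumrN; apply: eq_bigr => i _.
by rewrite (support_fun_min (hf i)).
Qed.

Lemma ncone_minkowski (R : realType) (n r : nat)
    (P : 'I_r -> set 'rV[R]_n) (y : 'rV[R]_n) (i : 'I_r) :
  (forall i, exists x, min_face (P i) y x) ->
  ncone (minkowski_sum P) y `<=` ncone (P i) y.
Proof.
move=> /choice[f hf]; apply: ncone_summand => x x' yx Px'.
pose upd z j := if j == i then z else f j.
have updE z : z + \sum_(j | j != i) f j = \sum_j upd z j.
  rewrite [RHS](bigD1 i) //= /upd eqxx; congr (_ + _); apply: eq_bigr => j.
  by move=> /negbTE->.
exists (\sum_(j | j != i) f j); rewrite !updE; split.
  by apply: min_face_minkowski => j; rewrite /upd; case: eqP => [->|].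
exists (upd x'); split=> // j; rewrite /upd; case: eqP => [->//|_].
by have [] := hf j.
Qed.

Lemma gen_minkowski (R : realType) (n r : nat) (P : 'I_r -> set 'rV[R]_n)
    (S_ : 'I_r -> seq 'rV[R]_n) (T : seq 'rV[R]_n) :
  (0 < r)%N -> (forall i, generated (P i) (S_ i) T) ->
  (forall i s, s \in S_ i -> integral s) ->
  exists S, generated (minkowski_sum P) S T /\ forall s, s \in S -> integral s.
Proof.
move=> r0 gP iS; have [S hS] := choice_sums S_; exists S.
split; last first.
  by move=> s /hS[f [fS ->]]; apply: lattice_sum => i _; apply: iS.
split.
- have /choice[f hf] : forall i, exists s, s \in S_ i.
    by move=> i; have [] := gP i; case: (S_ i) => // s l; exists s; rewrite mem_head.
  suff : \sum_i f i \in S by case: (S).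
  by apply/hS; exists f.
- move=> s /hS[f [fS ->]]; exists f; split=> // i.
  by have [_ SP _ _] := gP i; apply: SP.
- move=> _ t c [f [fP ->]] tT c0; pose i := Ordinal r0.
  exists (fun j => if j == i then f j + c *: t else f j); split.
    by move=> j; case: eqP => // _; have [_ _ PT _] := gP j; apply: PT.
  rewrite (bigD1 i) //= [in RHS](bigD1 i) //= addrAC; congr (_ + _).
  by apply: eq_bigr => j /negbTE->.
- move=> y Ty _ [f [fP ->]].
  have /choice[g hg] : forall i, exists s, s \in S_ i /\ dot s y <= dot (f i) y.
    move=> i; have [_ _ _ /(_ y Ty _ (fP i))[s sS sf]] := gP i.
    by exists s.
  exists (\sum_i g i); first by apply/hS; exists g; split=> // i; have [] := hg i.
  by rewrite !dot_suml; apply: ler_sum => i _; have [] := hg i.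
Qed.

Lemma min_face_add (R : realType) (n : nat) (P Q : set 'rV[R]_n)
    (y x z : 'rV[R]_n) :
  min_face P y x -> min_face Q y z ->
  min_face [set x + y | x in P & y in Q] y (x + z).
Proof.
move=> [Px hx] [Qz hz]; split; first by exists x => //; exists z.
by move=> _ [x' Px' [z' Qz' <-]]; rewrite !dotDl; apply: lerD; [apply: hx|apply: hz].
Qed.

Lemma gen_add (R : realType) (n : nat) (P Q : set 'rV[R]_n)
    (S1 S2 T : seq 'rV[R]_n) :
  generated P S1 T -> generated Q S2 T ->
  generated [set x + y | x in P & y in Q] [seq x + y | x <- S1, y <- S2] T.
Proof.
move=> [S10 SP PT hS1] [S20 SQ QT hS2]; split.
- by case: S1 S10 {SP hS1} => // ? ? _; case: S2 S20 {SQ hS2}.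
- by move=> _ /allpairsP[[x y]/= [/SP Px /SQ Qy ->]]; exists x => //; exists y.
- move=> _ t c [x Px [y Qy <-]] tT c0; exists (x + c *: t); first exact: PT.
  by exists y => //; rewrite addrAC.
- move=> w Tw _ [x Px [y Qy <-]].
  have [s sS1 sx] := hS1 w Tw x Px; have [s' s'S2 sy] := hS2 w Tw y Qy.
  exists (s + s'); last by rewrite !dotDl lerD.
  by apply/allpairsP; exists (s, s').
Qed.

(** * Full-dimensional cones of a fan and the slopes of convex functions *)

Definition full_dim (R : realType) (n : nat) (C : set 'rV[R]_n) : Prop :=
  forall y, (forall x, C x -> dot y x = 0) -> y = 0.

(** The sum of the generators is an interior point of the cone. *)
Lemma full_dim_hull (R : realType) (n : nat) (s : seq 'rV[R]_n) :
  full_dim (hull s) -> forall w, exists2 c, 0 <= c &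
    hull s (w + c *: \sum_(v <- s) v).
Proof.
move=> full w; suff /hull_cons[c [c0]] : hull (- (\sum_(v <- s) v) :: s) w.
  by rewrite scalerN opprK => h; exists c.
apply: contrapT => /farkas[a [ha aw]].
have a0 : \sum_(v <- s) dot v a <= 0.
  by rewrite -dot_suml -oppr_ge0 -dotNl dotC ha ?mem_head.
have av v : v \in s -> dot v a = 0.
  move: v; apply: sumr_le0_mem a0 => v vs.
  by rewrite dotC ha // inE vs orbT.
move: aw; rewrite (full a) ?dot0l ?ltxx // => x.
apply: (@hull_sub _ _ _ [set x | dot a x = 0]); last first.
  by move=> v /av; rewrite dotC.
split=> /= [|u v ua va|t u _ ua]; first by rewrite dot0r.
  by rewrite dotDr ua va addr0.
by rewrite dotZr ua mulr0.
Qed.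

Lemma generic_vector (R : realType) (n : nat) (l : seq 'rV[R]_n) :
  (forall a, a \in l -> a != 0) -> exists w, forall a, a \in l -> dot a w != 0.
Proof.
elim: l => [|a l IH] h; first by exists 0.
have [b bl|w hw] := IH; first by apply: h; rewrite inE bl orbT.
have [aw|aw] := eqVneq (dot a w) 0; last first.
  by exists w => b; rewrite inE => /predU1P[->|/hw].
have [e e0 he] : exists2 e : R, 0 < e &
    forall b, b \in l -> e * (2 * `|dot b a|) <= `|dot b w|.
  by apply: seq_small_step => b bl; split=> // /normr0_eq0 /eqP; rewrite (negbTE (hw b bl)).
exists (w + e *: a) => b; rewrite inE dotDr dotZr => /predU1P[->|bl].
  rewrite aw add0r mulf_neq0 ?gt_eqF //.
  by apply: dot_gt0; apply: h; rewrite mem_head.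
apply: contra_neq (hw b bl) => /eqP; rewrite addr_eq0 => /eqP bw.
have := he b bl; rewrite bw normrN normrM (gtr0_norm e0) => h1.
apply/eqP; rewrite oppr_eq0 -normr_eq0 normrM (gtr0_norm e0) eq_le; apply/andP.
by split; [lra|rewrite mulr_ge0 // ltW].
Qed.

Lemma seq_common_bound (R : realType) (T : eqType) (l : seq T)
    (Q : T -> R -> Prop) :
  (forall x, x \in l -> exists2 d, 0 < d & forall t, 0 < t < d -> Q x t) ->
  exists2 t, 0 < t & forall x, x \in l -> Q x t.
Proof.
move=> h; suff [d d0 hd] : exists2 d : R, 0 < d &
    forall x, x \in l -> forall t, 0 < t < d -> Q x t.
  exists (d / 2) => [|x xl]; first by rewrite divr_gt0.
  by apply: hd => //; apply/andP; split; lra.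
elim: l h => [|x l IH] h; first by exists 1.
have [y yl|d d0 hd] := IH; first by apply: h; rewrite inE yl orbT.
have [e e0 he] := h x (mem_head _ _).
exists (Num.min d e) => [|y]; first by rewrite lt_min d0.
rewrite inE => /predU1P[->|yl] t; rewrite lt_min => /and3P[t0 td te].
  by apply: he; rewrite t0.
by apply: hd => //; rewrite t0.
Qed.

(** Move [z] in a direction outside the hyperplanes that contain the cones of
    smaller dimension: the cones met by all small displacements are
    full-dimensional, and they contain [z] because they are closed. *)
Lemma fan_full_dim_cover (R : realType) (n : nat) (F : set (set 'rV[R]_n))
    (z : 'rV[R]_n) :
  is_fan F -> convex_cone (fan_support F) ->
  (forall w, fan_support F w \/ fan_support F (- w)) -> fan_support F z ->
  exists C, [/\ F C, C z & full_dim C].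
Proof.
move=> [/finite_seqP[l Fl] rF _ _] [_ DD DZ] Dw Dz; apply: contrapT => none.
have /choice[a ha] : forall C : set 'rV[R]_n, exists a, ~ full_dim C ->
    a != 0 /\ forall x, C x -> dot a x = 0.
  move=> C; have [fC|/existsNP[a /not_implyP[aC a0]]] := pselect (full_dim C).
    by exists 0.
  by exists a => _; split=> //; apply/eqP.
have [|w0 hw0] := @generic_vector R n [seq a C | C <- l & `[< ~ full_dim C >]].
  by move=> _ /mapP[C + ->]; rewrite mem_filter => /andP[/asboolP/ha[]].
have [w [{}Dw hw]] : exists w, fan_support F w /\
    forall C, C \in l -> ~ full_dim C -> dot (a C) w != 0.
  have hw0' C : C \in l -> ~ full_dim C -> dot (a C) w0 != 0.
    move=> Cl nC; apply: hw0; apply/map_f; rewrite mem_filter Cl andbT.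
    exact/asboolP.
  have [Dw0|Dw0] := Dw w0; first by exists w0.
  by exists (- w0); split=> // C Cl nC; rewrite dotNr oppr_eq0 hw0'.
have [t t0 ht] : exists2 t : R, 0 < t & forall C, C \in l -> ~ C (z + t *: w).
  apply: seq_common_bound => C Cl.
  have [fC|nC] := pselect (full_dim C); last first.
    have [a0 aC] := ha C nC; have aw := hw C Cl nC.
    pose u := - dot (a C) z / dot (a C) w.
    have uE t : C (z + t *: w) -> t = u.
      move=> /aC; rewrite dotDr dotZr => /eqP; rewrite addrC addr_eq0 => /eqP tE.
      by rewrite /u -tE mulfK.
    have [u0|u0] := ltP 0 u.
      by exists u => // t /andP[_ tu] /uE tE; rewrite tE ltxx in tu.
    by exists 1; rewrite ?ltr01 // => t /andP[t0 _] /uE tE; rewrite tE ltNge u0 in t0.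
  have nCz : ~ C z by move=> Cz; apply: none; exists C; split=> //; rewrite Fl.
  have [[s [_ Cs]] _] : rational_cone C /\ strongly_convex C by apply: rF; rewrite Fl.
  have [A [CA _]] := hull_halfspaces s; rewrite /hull -Cs in CA.
  have [b bA bz] : exists2 b, b \in A & dot b z < 0.
    apply: contrapT => h; apply: nCz; rewrite CA => b bA.
    by rewrite leNgt; apply/negP => bz; apply: h; exists b.
  rewrite CA; have [bw|bw] := leP (dot b w) 0.
    exists 1; rewrite ?ltr01 // => t /andP[t0 _] /(_ b bA).
    by rewrite dotDr dotZr; nra.
  exists (- dot b z / dot b w); first by rewrite divr_gt0 ?oppr_gt0.
  move=> t /andP[t0]; rewrite ltr_pdivlMr // => tb /(_ b bA).
  by rewrite dotDr dotZr; lra.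
have [C] : fan_support F (z + t *: w) by apply: DD => //; apply: DZ => //; exact: ltW.
by rewrite Fl => Cl /(ht C Cl).
Qed.

(** From any [x], moving far along an interior direction of a full-dimensional
    cone leads into the cone, where [f] is linear; subadditivity then bounds [f x]
    below by the slope of that cone. *)
Lemma convex_slope (R : realType) (n : nat) (F : set (set 'rV[R]_n))
    (f : 'rV[R]_n -> R) (z : 'rV[R]_n) :
  is_fan F -> convex_cone (fan_support F) ->
  (forall w, fan_support F w \/ fan_support F (- w)) ->
  piecewise_linear F f -> convex_on (fan_support F) f -> fan_support F z ->
  exists q C, [/\ F C, C z, full_dim C, forall x, C x -> f x = dot q x
    & forall x, fan_support F x -> dot q x <= f x].
Proof.
move=> fF cD tD fl fc Dz; have [C [FC Cz fC]] := fan_full_dim_cover fF cD tD Dz.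
have [q hq] := fl C FC; exists q, C; split=> // x Dx.
have [_ rF _ _] := fF; have [[s [_ Cs]] _] := rF C FC.
rewrite Cs in fC hq; have [_ _ HZ] := hull_cone s.
have [c c0 xc] := full_dim_hull fC x.
have cs : hull s (c *: \sum_(v <- s) v).
  by apply: HZ => //; apply: cone_sum; [exact: hull_cone|move=> v; apply: hull_gen].
have Fs v : hull s v -> fan_support F v by exists C => //; rewrite Cs.
have := fc _ _ Dx (Fs _ cs); rewrite (hq _ xc) (hq _ cs) dotDr; lra.
Qed.

(** Far enough inside the cone every unit vector becomes a difference of two
    lattice points of the cone. *)
Lemma lattice_slope (R : realType) (n : nat) (C : set 'rV[R]_n) (q : 'rV[R]_n) :
  rational_cone C -> full_dim C ->
  (forall x, C x -> integral x -> dot q x \is a Num.int) -> integral q.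
Proof.
move=> [s [is_ ->]] fC hq; apply/mxOverP => i j; rewrite ord1.
have [_ HD HZ] := hull_cone s; set p := \sum_(v <- s) v.
have ps : hull s p by apply: cone_sum; [exact: hull_cone|move=> v; apply: hull_gen].
have ip : integral p by apply: lattice_sum.
have [c c0 hc] := full_dim_hull fC (delta_mx 0 j).
pose N : R := (Num.bound c)%:R; have cN : c <= N by exact/ltW/archi_boundP.
have iN : integral (delta_mx 0 j + N *: p).
  by apply: latticeD; [exact: lattice_delta|apply: latticeZ; rewrite ?rpred_nat].
have hN : hull s (delta_mx 0 j + N *: p).
  rewrite -(subrK c N) scalerDl addrCA; apply: HD => //.
  by apply: HZ; rewrite ?subr_ge0.
rewrite -(dot_delta q j) -(addrK (N *: p) (delta_mx 0 j)) dotDr dotNr.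
apply: rpredB; first exact: hq.
by rewrite dotZr rpredM ?rpred_nat ?hq.
Qed.

(** * Crepant subdivisions and polyhedra over the pieces of a nef-partition *)

Lemma dot_continuous (R : realType) (n : nat) (y : 'rV[R]_n) :
  continuous (dot y).
Proof.
apply: continuous_big; first exact: add_continuous.
move=> i _ x; have h := @cvgM R _ (nbhs x) _ (fun=> y 0 i)
  (fun x : 'rV[R]_n => x 0 i) (y 0 i) (x 0 i).
by apply: h; [exact: cvg_cst|exact: coord_continuous].
Qed.

(** The support function of [P] is the gauge of its polar, so it takes the value
    [1] on the boundary of the latter. *)
Lemma support_fun_boundary (R : realType) (n : nat) (P : set 'rV[R]_n)
    (S : seq 'rV[R]_n) (u : 'rV[R]_n) :
  generated P S [::] -> boundary (polar P) u -> support_fun P u = 1.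
Proof.
move=> gP [cu nu]; have [_ SP _ hS] := gP.
have T0 x : halfspaces ([::] : seq 'rV[R]_n) x by [].
have [s sS us] := gen_argmin gP (T0 u); rewrite (support_fun_min us).
suff : dot s u = -1 by move=> ->; rewrite opprK.
apply/eqP; rewrite eq_le; apply/andP; split.
  rewrite leNgt; apply/negP => su; apply: nu.
  have : \forall x \near u, forall v, v \in S -> -1 < dot v x.
    have hv v : v \in S -> -1 < dot v u.
      by move=> vS; exact: lt_le_trans su (us.2 _ (SP _ vS)).
    elim: S hv {gP SP hS sS} => [_|v S IH hv]; first exact: filterE.
    have vu : \forall x \near u, -1 < dot v x.
      apply: (@cvgr_gt R _ (nbhs u) _ (dot v) (dot v u)).
        exact: dot_continuous.
      by apply: hv; rewrite mem_head.
    have wu : \forall x \near u, forall w, w \in S -> -1 < dot w x.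
      by apply: IH => w wS; apply: hv; rewrite inE wS orbT.
    apply: filterS2 vu wu => x vx wx w; rewrite inE => /predU1P[->//|].
    exact: wx.
  apply: filterS => x Sx z Pz; have [v vS] := hS x (T0 x) z Pz.
  by apply: le_trans; apply/ltW/Sx.
have : closed [set x | -1 <= dot s x].
  by apply: (@preimage_closed _ _ (dot s) [set x | -1 <= x]);
    [move=> x _; exact: dot_continuous|exact: closed_ge].
move=> /closure_id sE; have : closure [set x | -1 <= dot s x] u.
  by apply: closure_subset cu => x /(_ s (SP _ sS)).
by rewrite -sE.
Qed.

Lemma interior0_lt (R : realType) (n : nat) (P : set 'rV[R]_n) (y : 'rV[R]_n) :
  P° 0 -> y != 0 -> exists2 x, P x & dot x y < 0.
Proof.
move=> /nbhs_ballP[e /= e0 eP] y0.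
pose M := 1 + \sum_i `|y 0 i|; have M0 : 0 < M by rewrite ltr_pwDl ?sumr_ge0.
exists (- (e / M / 2) *: y); last first.
  by rewrite dotZl mulNr oppr_lt0 mulr_gt0 ?dot_gt0 // !divr_gt0.
apply: eP; split=> // i j; rewrite ord1 -ball_normE /= !mxE sub0r normrN normrM.
rewrite normrN (gtr0_norm (_ : 0 < e / M / 2)) ?divr_gt0 //.
have yM : `|y 0 j| < M.
  by rewrite /M (bigD1 j) //= addrCA ltrDl ltr_pwDl ?sumr_ge0.
apply: (@le_lt_trans _ _ (e / M / 2 * M)).
  by rewrite ler_wpM2l ?(ltW yM) // !divr_ge0 // ltW.
have -> : e / M / 2 * M = e / 2 by field; rewrite gt_eqF.
lra.
Qed.

Lemma sum1_delta (R : realType) (r : nat) (a : 'I_r -> R) :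
  (forall i, 0 <= a i) -> (forall i, a i \is a Num.int) -> \sum_i a i = 1 ->
  exists j, forall i, a i = (i == j)%:R.
Proof.
move=> a0 ai a1; have [j aj] : exists j, a j != 0.
  apply: contrapT => h; have := oner_neq0 R; rewrite -a1 big1 ?eqxx // => i _.
  by apply/eqP/negPn/negP => hi; apply: h; exists i.
have aj1 : 1 <= a j by rewrite -(ger0_norm (a0 j)) norm_intr_ge1.
have := a1; rewrite (bigD1 j) //= => aE.
have s0 : 0 <= \sum_(i | i != j) a i by apply: sumr_ge0.
exists j => i; case: (eqVneq i j) => [->|ij]; first by rewrite /=; lra.
have : \sum_(i | i != j) a i <= 0 by lra.
rewrite (bigD1 i) //= => hi; apply/eqP; rewrite eq_le a0 andbT.
by apply: le_trans hi; rewrite lerDl sumr_ge0.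
Qed.

Lemma support_fun_ge0 (R : realType) (n : nat) (P : set 'rV[R]_n)
    (S T : seq 'rV[R]_n) (y : 'rV[R]_n) :
  generated P S T -> P 0 -> halfspaces T y -> 0 <= support_fun P y.
Proof.
by move=> gP P0 Ty; have := support_fun_ge gP Ty P0; rewrite dot0l oppr0.
Qed.

Lemma halfspaces_nil (R : realType) (n : nat) (x : 'rV[R]_n) : halfspaces [::] x.
Proof. by []. Qed.

Lemma gen_min (R : realType) (n : nat) (P : set 'rV[R]_n)
    (S T : seq 'rV[R]_n) (y : 'rV[R]_n) :
  generated P S T -> halfspaces T y -> exists s, min_face P y s.
Proof. by move=> gP /(gen_argmin gP)[s _ ys]; exists s. Qed.

Definition pieces (R : realType) (n r : nat) (W : 'I_r -> set 'rV[R]_n)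
    (G : 'I_r -> seq 'rV[R]_n) : Prop :=
  forall i, [/\ generated (W i) (G i) [::], forall s, s \in G i -> integral s
    & W i 0].

Lemma support_fun_pieces (R : realType) (n r : nat) (W : 'I_r -> set 'rV[R]_n)
    (G : 'I_r -> seq 'rV[R]_n) (x : 'rV[R]_n) :
  pieces W G -> support_fun (minkowski_sum W) x = \sum_i support_fun (W i) x.
Proof.
move=> pW; apply: support_fun_minkowski => i; have [gW _ _] := pW i.
exact: gen_min gW (halfspaces_nil x).
Qed.

Lemma crepant_ray (R : realType) (n r : nat) (W : 'I_r -> set 'rV[R]_n)
    (G : 'I_r -> seq 'rV[R]_n) (F' : set (set 'rV[R]_n)) (C : set 'rV[R]_n) :
  (0 < r)%N -> pieces W G ->
  crepant_subdivision (polar (minkowski_sum W)) F' (normal_fan (minkowski_sum W)) ->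
  F' C -> is_ray C -> exists u j, [/\ C = ray u, integral u &
    forall i, support_fun (W i) u = (i == j)%:R].
Proof.
move=> r0 pW [_ crep] FC rC; have [u [iu bu ->]] := crep C FC rC; exists u.
have [S [gS _]] : exists S, generated (minkowski_sum W) S [::] /\
    forall s, s \in S -> integral s.
  by apply: (gen_minkowski (S_ := G)) => // i; have [] := pW i.
have [|||j hj] := @sum1_delta R r (fun i => support_fun (W i) u).
- by move=> i; have [gW _ W0] := pW i; apply: support_fun_ge0 gW W0 (halfspaces_nil u).
- by move=> i; have [gW iG _] := pW i; apply: support_fun_lattice gW iG (halfspaces_nil u) iu.
- by rewrite -(support_fun_pieces u pW) (support_fun_boundary gS bu).
by exists j.
Qed.

Lemma ray_scale (R : realType) (n : nat) (u v : 'rV[R]_n) :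
  ray u = ray v -> exists2 t, 0 <= t & u = t *: v.
Proof. by move=> uv; have := ray_mem u; rewrite uv. Qed.

Lemma hull_map_ray (R : realType) (n : nat) (s : seq 'rV[R]_n)
    (g : 'rV[R]_n -> 'rV[R]_n) :
  (forall v, v \in s -> ray v = ray (g v)) -> hull [seq g v | v <- s] = hull s.
Proof.
move=> h; apply/seteqP; split; apply: hull_sub; try exact: hull_cone.
  move=> _ /mapP[v vs ->]; have [t t0 ->] := ray_scale (esym (h v vs)).
  by have [_ _ HZ] := hull_cone s; apply: HZ => //; apply: hull_gen.
move=> v vs; have [t t0 ->] := ray_scale (h v vs).
have [_ _ HZ] := hull_cone [seq g v | v <- s]; apply: HZ => //.
by apply: hull_gen; apply: map_f.
Qed.

Lemma crepant_gens (R : realType) (n r : nat) (W : 'I_r -> set 'rV[R]_n)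
    (G : 'I_r -> seq 'rV[R]_n) (F' : set (set 'rV[R]_n)) :
  (0 < r)%N -> pieces W G ->
  crepant_subdivision (polar (minkowski_sum W)) F' (normal_fan (minkowski_sum W)) ->
  exists U : seq 'rV[R]_n,
    (forall u, u \in U -> integral u /\
       exists j, forall i, support_fun (W i) u = (i == j)%:R) /\
    forall C, F' C -> exists s, {subset s <= U} /\ C = hull s.
Proof.
move=> r0 pW crep; have [[fF _ _] _] := crep.
pose good_gen u := integral u /\
  exists j, forall i, support_fun (W i) u = (i == j)%:R.
have /choice[s hs] : forall C, exists s : seq 'rV[R]_n, F' C ->
    C = hull s /\ forall u, u \in s -> good_gen u.
  move=> C; have [FC|nF] := pselect (F' C); last by exists [::].
  have [s [Cs _ sF]] := fan_rays fF FC.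
  have /choice[g hg] : forall v, exists u, v \in s -> ray v = ray u /\ good_gen u.
    move=> v; have [vs|_] := boolP (v \in s); last by exists 0.
    have [v0 Fv] := sF v vs.
    have [|u [j [vu iu uj]]] := crepant_ray r0 pW crep Fv; first by exists v.
    by exists u => _; split=> //; split=> //; exists j.
  exists [seq g v | v <- s] => _; split.
    by rewrite hull_map_ray // => v /hg[].
  by move=> _ /mapP[v /hg[_ ?] ->].
have [/finite_seqP[l Fl] _ _ _] := fF.
exists (flatten [seq s C | C <- l]); split=> [u|C FC].
  move=> /flattenP[_ /mapP[C Cl ->]] us.
  by have [|_] := hs C; [rewrite Fl|apply].
exists (s C); split; last by have [] := hs C FC.
move=> u us; apply/flattenP; exists (s C) => //; apply/map_f.
by move: FC; rewrite Fl.
Qed.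

Lemma subdivision_ncone (R : realType) (n : nat) (P : set 'rV[R]_n)
    (S T : seq 'rV[R]_n) (F' : set (set 'rV[R]_n)) (C : set 'rV[R]_n) :
  generated P S T -> subdivision F' (normal_fan P) -> F' C ->
  exists2 y, halfspaces T y & C `<=` ncone P y.
Proof.
move=> gP [_ _ sub] /sub[D /(normal_fanE _ gP)[y [Ty ->]] CD].
by exists y.
Qed.

(** Each piece is a Minkowski summand, so its normal fan is coarser than that of
    the sum. *)
Lemma crepant_linear (R : realType) (n r : nat) (W : 'I_r -> set 'rV[R]_n)
    (G : 'I_r -> seq 'rV[R]_n) (F' : set (set 'rV[R]_n)) (C : set 'rV[R]_n) :
  (0 < r)%N -> pieces W G -> subdivision F' (normal_fan (minkowski_sum W)) ->
  F' C -> forall i, linear_on C (support_fun (W i)).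
Proof.
move=> r0 pW subF FC i.
have [S [gS _]] : exists S, generated (minkowski_sum W) S [::] /\
    forall s, s \in S -> integral s.
  by apply: (gen_minkowski (S_ := G)) => // j; have [] := pW j.
have [y _ Cy] := subdivision_ncone gS subF FC.
have [gW _ _] := pW i; have [m hm] := support_fun_linear gW (halfspaces_nil y).
exists m => x /Cy; move=> hx; apply: hm; apply: ncone_minkowski hx => j.
by have [gWj _ _] := pW j; apply: gen_min gWj (halfspaces_nil y).
Qed.

Lemma linear_on_sum (R : realType) (n : nat) (I : Type) (s : seq I)
    (D : set 'rV[R]_n) (f : I -> 'rV[R]_n -> R) :
  (forall i, linear_on D (f i)) -> linear_on D (fun x => \sum_(i <- s) f i x).
Proof.
move=> /choice[m hm]; exists (\sum_(i <- s) m i) => x Dx.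
by rewrite dot_suml; apply: eq_bigr => i _; apply: hm.
Qed.

Lemma linear_onB (R : realType) (n : nat) (D : set 'rV[R]_n)
    (f g : 'rV[R]_n -> R) :
  linear_on D f -> linear_on D g -> linear_on D (f \- g).
Proof.
by move=> [p hp] [q hq]; exists (p - q) => x Dx; rewrite /= dotBl hp ?hq.
Qed.

(** On a cone of a crepant subdivision both sides are linear in [x], and on a
    generator, which has weight [1] for exactly one piece [j], the claim is the
    bound [mu j] itself.  It replaces the decomposition of [x] as a combination
    of generators. *)
Lemma weighted_bound (R : realType) (n r : nat) (W : 'I_r -> set 'rV[R]_n)
    (G : 'I_r -> seq 'rV[R]_n) (F' : set (set 'rV[R]_n)) (f k : 'rV[R]_n -> R)
    (Q : 'I_r -> set 'rV[R]_n) :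
  (0 < r)%N -> pieces W G ->
  crepant_subdivision (polar (minkowski_sum W)) F' (normal_fan (minkowski_sum W)) ->
  (forall j x, Q j x <-> forall i, support_fun (W i) x <= (i == j)%:R) ->
  integral_piecewise_linear F' f ->
  (forall x, k x = f x - \sum_i support_fun (W i) x) ->
  exists S_ : 'I_r -> seq 'rV[R]_(n + 1), [/\
    forall j s, s \in S_ j -> integral s /\ epigraph (Q j) k s,
    forall j, 0 \in S_ j &
    forall x a b (mu : 'I_r -> R), 0 <= b ->
      (forall j s, s \in S_ j -> mu j <= dot s (pt a b)) ->
      \sum_j mu j * support_fun (W j) x <= dot x a + b * k x].
Proof.
move=> r0 pW crep QW [fl fi] kE; have [U [hU genF]] := crepant_gens r0 pW crep.
have [subF _] := crep; have [S [gS _]] : exists S,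
    generated (minkowski_sum W) S [::] /\ forall s, s \in S -> integral s.
  by apply: (gen_minkowski (S_ := G)) => // i; have [] := pW i.
have FT x : fan_support F' x.
  by have [_ -> _] := subF; rewrite (normal_fan_support gS).
have Wlin C : F' C -> forall i, linear_on C (support_fun (W i)).
  exact: crepant_linear r0 pW subF.
have klin C : F' C -> linear_on C k.
  move=> FC; have [m hm] := linear_onB (fl C FC) (linear_on_sum (index_enum _) (Wlin C FC)).
  by exists m => x Cx; rewrite kE -hm.
have zero C : F' C -> C 0.
  by move=> /genF[s [_ ->]]; have [] := hull_cone s.
have k0 : k 0 = 0.
  by have [C FC C0] := FT 0; have [m ->] := klin C FC; rewrite ?dot0r //.
have W0 i : support_fun (W i) 0 = 0.
  by have [C FC C0] := FT 0; have [m ->] := Wlin C FC i; rewrite ?dot0r.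
exists (fun j => 0 :: [seq pt u (k u) | u <- U & `[< Q j u >]]); split.
- move=> j s; rewrite inE => /predU1P[->|/mapP[u]].
    split; first exact: lattice0.
    exists 0, 0; rewrite k0 pt0; split=> //; apply/QW => i; rewrite W0.
    by case: eqP.
  rewrite mem_filter => /andP[/asboolP Qu uU] ->; split; last by exists u, (k u).
  have [iu [l ul]] := hU u uU; apply/lattice_pt; split=> //.
  rewrite kE rpredB ?fi //; apply: rpred_sum => i _.
  by rewrite ul rpred_nat.
- by move=> j; rewrite mem_head.
move=> x a b mu b0 hmu; have [C FC Cx] := FT x.
have [s [sU Cs]] := genF C FC; have [p hp] := choice (Wlin C FC).
have [q hq] := klin C FC.
suff : 0 <= dot (a + b *: q - \sum_j mu j *: p j) x.
  rewrite dotDl dotNl subr_ge0 dotDl dotZl dot_suml (dotC a) -hq //.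
  apply: le_trans; apply: ler_sum => j _.
  by rewrite dotZl hp.
move: Cx; rewrite {1}Cs; set w := (_ - _) => Cx.
apply: (@hull_sub _ _ s [set x | 0 <= dot w x]) Cx => [|u us /=].
  split=> [|y z /= hy hz|t y t0 /= hy]; first by rewrite /= dot0r.
    by rewrite dotDr addr_ge0.
  by rewrite dotZr mulr_ge0.
have [iu [j uj]] := hU u (sU u us).
have Cu : C u by rewrite Cs; apply: hull_gen.
have Qu : Q j u by apply/QW => i; rewrite uj.
rewrite /w dotDl dotNl subr_ge0 dotDl dotZl dot_suml (dotC a) -hq //.
rewrite (bigD1 j) //= big1 ?addr0 => [|i ij]; last first.
  by rewrite dotZl -hp // uj (negbTE ij) mulr0.
rewrite dotZl -hp // uj eqxx mulr1; have := hmu j (pt u (k u)).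
rewrite dot_pt (mulrC (k u)); apply; rewrite inE (map_f (fun u => pt u (k u))) ?orbT //.
by rewrite mem_filter sU // andbT; apply/asboolP.
Qed.

Definition upward (R : realType) (n : nat) : seq 'rV[R]_(n + 1) := [:: pt 0 1].

Lemma halfspaces_up (R : realType) (n : nat) (a : 'rV[R]_n) (b : R) :
  halfspaces (upward R n) (pt a b) <-> 0 <= b.
Proof.
split=> [/(_ (pt 0 1))|b0 t]; rewrite inE; last move=> /eqP->.
  by rewrite eqxx dot_pt dot0l add0r mul1r; apply.
by rewrite dot_pt dot0l add0r mul1r.
Qed.

Lemma epigraph_up (R : realType) (n : nat) (P : set 'rV[R]_n)
    (k : 'rV[R]_n -> R) x t c :
  epigraph P k x -> t \in upward R n -> 0 <= c -> epigraph P k (x + c *: t).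
Proof.
move=> [m [l [Pm kl ->]]]; rewrite inE => /eqP-> c0.
exists m, (l + c); rewrite ptZ ptD scaler0 addr0 mulr1; split=> //.
by apply: le_trans kl _; rewrite lerDl.
Qed.

(** The lower bound is [weighted_bound] with [mu] the minima over the lists found
    there.  They are nonpositive, because the lists contain the origin; a point of
    [Q j] has weight at most [1] in the piece [j] and [0] in the others, and a
    point of the Minkowski sum has weight at most [1] in every piece.  Convexity
    of [k] puts the sums of points of the lists into the second polyhedron. *)
Lemma gen_epigraphs (R : realType) (n r : nat) (W : 'I_r -> set 'rV[R]_n)
    (G : 'I_r -> seq 'rV[R]_n) (F' : set (set 'rV[R]_n)) (f k : 'rV[R]_n -> R)
    (Q : 'I_r -> set 'rV[R]_n) :
  (0 < r)%N -> pieces W G ->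
  crepant_subdivision (polar (minkowski_sum W)) F' (normal_fan (minkowski_sum W)) ->
  (forall j x, Q j x <-> forall i, support_fun (W i) x <= (i == j)%:R) ->
  integral_piecewise_linear F' f ->
  (forall x, k x = f x - \sum_i support_fun (W i) x) ->
  (exists S_ : 'I_r -> seq 'rV[R]_(n + 1), forall j,
     generated (epigraph (Q j) k) (S_ j) (upward R n) /\
     forall s, s \in S_ j -> integral s) /\
  (convex_on setT k -> exists S : seq 'rV[R]_(n + 1),
     generated (epigraph (minkowski_sum Q) k) S (upward R n) /\
     forall s, s \in S -> integral s).
Proof.
move=> r0 pW crep QW fF kE.
have [S_ [SQ S0 bound]] := weighted_bound r0 pW crep QW fF kE.
have Wge0 i x : 0 <= support_fun (W i) x.
  by have [gW _ W0] := pW i; apply: support_fun_ge0 gW W0 (halfspaces_nil x).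
have mins y : exists g : 'I_r -> 'rV[R]_(n + 1), forall j,
    [/\ g j \in S_ j, dot (g j) y <= 0 & forall s, s \in S_ j -> dot (g j) y <= dot s y].
  suff /choice[g hg] : forall j, exists g, [/\ g \in S_ j, dot g y <= 0
    & forall s, s \in S_ j -> dot g y <= dot s y] by exists g.
  move=> j; have Sj0 : S_ j != [::] by case: (S_ j) (S0 j).
  have [g gS hg] := seq_argmin (fun s => dot s y) Sj0.
  by exists g; split=> //; rewrite -(dot0l y); apply: hg.
split.
  exists S_ => j; split; last by move=> s /SQ[].
  split; [by case: (S_ j) (S0 j)|by move=> s /SQ[]|move=> *; exact: epigraph_up|].
  move=> y Ty z [m [l [Qm kl ->]]]; have [g hg] := mins y.
  have [gS g0 _] := hg j; exists (g j) => //.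
  have [a [b yE]] := pt_surj y; rewrite yE in Ty hg g0 *.
  have b0 : 0 <= b by move/halfspaces_up: Ty.
  have hgm i s : s \in S_ i -> dot (g i) (pt a b) <= dot s (pt a b).
    by have [_ _] := hg i; apply.
  have := bound m a b _ b0 hgm; rewrite dot_pt => h.
  apply: le_trans (_ : dot m a + b * k m <= _); last first.
    by rewrite lerD2l mulrC ler_wpM2r.
  apply: le_trans h; rewrite (bigD1 j) //= -[leLHS]addr0; apply: lerD.
    have := (QW j m).1 Qm j; rewrite eqxx => Wj.
    by rewrite -[leLHS]mulr1 ler_wnM2l.
  apply: sumr_ge0 => i ij; have := (QW j m).1 Qm i; rewrite (negbTE ij) => Wi.
  have -> : support_fun (W i) m = 0 by apply/eqP; rewrite eq_le Wi Wge0.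
  by rewrite mulr0.
move=> kc; have [S hS] := choice_sums S_; exists S; split; last first.
  by move=> s /hS[h [hh ->]]; apply: lattice_sum => i _; have [] := SQ i _ (hh i).
split.
- suff : 0 \in S by case: (S).
  by apply/hS; exists (fun=> 0); split=> //; rewrite big1.
- move=> s /hS[h [hh ->]].
  have /choice[m hm] : forall i, exists m : 'rV[R]_n * R,
      [/\ Q i m.1, k m.1 <= m.2 & h i = pt m.1 m.2].
    by move=> i; have [_ [m [l [? ? ?]]]] := SQ i _ (hh i); exists (m, l).
  exists (\sum_i (m i).1), (\sum_i (m i).2); split.
  + by exists (fun i => (m i).1); split=> // i; have [] := hm i.
  + apply: (@le_trans _ _ (\sum_i k (m i).1)); last first.
      by apply: ler_sum => i _; have [] := hm i.
    have k0 : k 0 <= 0.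
      have [_ [m' [l [_ kl pE]]]] := SQ (Ordinal r0) 0 (S0 _).
      by have [m0 l0] := pt_inj (etrans (pt0 R n) pE); rewrite -m0 -l0 in kl.
    elim/big_rec2: _ => // i y z _ IH.
    by apply: le_trans (kc _ _ _ _) _ => //; rewrite lerD2l.
  + by rewrite -pt_sum; apply: eq_bigr => i _; have [] := hm i.
- by move=> *; exact: epigraph_up.
move=> y Ty z [m [l [[q [Qq mE]] kl ->]]]; have [g hg] := mins y.
have [a [b yE]] := pt_surj y; rewrite yE in Ty hg *.
have b0 : 0 <= b by move/halfspaces_up: Ty.
exists (\sum_i g i); first by apply/hS; exists g; split=> // i; have [] := hg i.
have hgm i s : s \in S_ i -> dot (g i) (pt a b) <= dot s (pt a b).
  by have [_ _] := hg i; apply.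
have := bound m a b _ b0 hgm; rewrite dot_pt => h.
apply: le_trans (_ : dot m a + b * k m <= _); last first.
  by rewrite lerD2l mulrC ler_wpM2r.
apply: le_trans h; rewrite dot_suml; apply: ler_sum => i _.
have [_ g0 _] := hg i; rewrite -[leLHS]mulr1 ler_wnM2l //.
(* each weight is at most [1] on the sum, by subadditivity *)
apply: (@le_trans _ _ (\sum_j support_fun (W i) (q j))).
  have [gW _ _] := pW i; rewrite mE; elim/big_rec2: _ => [|j u v _ IH].
    by have [s _ us] := gen_argmin gW (halfspaces_nil 0);
      rewrite (support_fun_min us) dot0r oppr0.
  apply: le_trans (support_funD gW (halfspaces_nil _) (halfspaces_nil _)) _.
  by rewrite lerD2l.
apply: (@le_trans _ _ (\sum_j (i == j)%:R)).
  by apply: ler_sum => j _; apply: (QW j (q j)).1.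
by rewrite (bigD1 i) //= eqxx big1 ?addr0 // => j /negbTE; rewrite eq_sym => ->.
Qed.

(** * Duality of nef-partitions *)

Lemma lattice_polytope_gen (R : realType) (n : nat) (P : set 'rV[R]_n) :
  lattice_polytope P -> P !=set0 -> exists S, [/\ generated P S [::],
    forall s, s \in S -> integral s & P = conv [set` S]].
Proof.
move=> [S [iS ->]] [x Px]; exists S; split=> //; split=> //.
- have [s sS _] := conv_argmin 0 Px; by case: (S) sS.
- by move=> s sS; apply: conv_gen.
- by move=> y _ z; apply: conv_argmin.
Qed.

Lemma full_interior (R : realType) (n : nat) (P : set 'rV[R]_n)
    (S T : seq 'rV[R]_n) (y : 'rV[R]_n) :
  generated P S T -> P° 0 -> halfspaces T y -> halfspaces T (- y) ->
  (forall s s', s \in S -> s' \in S -> dot s y <= dot s' y) -> y = 0.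
Proof.
move=> [_ _ _ hS] P0 Ty Ty' h; apply/eqP/negPn/negP => y0.
have [x Px xy] := interior0_lt P0 y0; have [s sS sx] := hS y Ty x Px.
have [|x' Px'] := @interior0_lt _ _ _ (- y) P0; first by rewrite oppr_eq0.
have [s' s'S] := hS _ Ty' x' Px'; rewrite !dotNr => sx' xy'.
have := h _ _ s'S sS; lra.
Qed.

(** Divide [v] by the largest integer that leaves it in the lattice. *)
Lemma lattice_primitive (R : realType) (n : nat) (v : 'rV[R]_n) :
  integral v -> v != 0 -> exists e, primitive e /\ ray e = ray v.
Proof.
move=> iv v0; have [j vj] : exists j, v 0 j != 0.
  apply: contrapT => h; move/eqP: v0; apply; apply/rowP => j; rewrite mxE.
  by apply/eqP/negPn/negP => hj; apply: h; exists j.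
pose Q k := `[< exists w : 'rV[R]_n, integral w /\ v = k%:R *: w >].
have Q1 : exists k, Q k by exists 1%N; apply/asboolP; exists v; rewrite scale1r.
have Qb k : Q k -> (k <= Num.bound `|v ord0 j|%R)%N.
  move=> /asboolP[w [/mxOverP iw vE]]; rewrite -(ler_nat R).
  apply: le_trans (ltW (archi_boundP _)); rewrite ?normr_ge0 //.
  move: vj; rewrite vE mxE mulf_eq0 negb_or => /andP[_ wj].
  by rewrite normrM normr_nat ler_peMr ?ler0n // norm_intr_ge1.
case: (ex_maxnP Q1 Qb) => k /asboolP[w [iw vE]] kmax; exists w.
have k0 : (0 < k)%N.
  by rewrite lt0n; apply: contraNneq v0 => k0; rewrite vE k0 scale0r.
split.
  split=> // l u iu wE; have : (k * l <= k)%N.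
    by apply: kmax; apply/asboolP; exists u; rewrite vE wE scalerA natrM.
  rewrite -[leqRHS]muln1 leq_pmul2l // => l1; apply/eqP; rewrite eqn_leq l1 lt0n /=.
  by apply: contraNneq v0 => l0; rewrite vE wE l0 scale0r scaler0.
have kR : 0 < k%:R :> R by rewrite ltr0n.
apply/seteqP; split=> _ [t t0 ->]; last first.
  by exists (t * k%:R); rewrite ?mulr_ge0 ?ler0n // vE scalerA.
exists (t / k%:R); first by rewrite divr_ge0 ?ler0n.
by rewrite vE scalerA -mulrA mulVf ?mulr1 ?gt_eqF.
Qed.

(** The primitive generators of the rays are vertices of the polar polytope:
    scaled to height [1], such a generator is where the sum of the vertices of
    its facet is minimal on the polar polytope, so it is a lattice point. *)
Lemma reflexive_ray_generator (R : realType) (n : nat) (P : set 'rV[R]_n)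
    (e : 'rV[R]_n) :
  reflexive_polytope P -> ray_generators (normal_fan P) e -> support_fun P e = 1.
Proof.
move=> [lP P0 lP'] [pe re].
have e0 : e != 0.
  apply/eqP => e0; have [_ /(_ 0%N 0 (lattice0 R n))] := pe.
  by rewrite scale0r e0 => /(_ erefl).
have Pe : P 0 by apply: interior_subset P0.
have [S [gP iS PE]] := lattice_polytope_gen lP (ex_intro _ 0 Pe).
have [|S' [gP' iS' PE']] := lattice_polytope_gen lP'.
  by exists 0 => x Px; rewrite dot0r oppr_le0.
have Tnil := @halfspaces_nil R n; have [_ SP _ _] := gP.
set c := support_fun P e; have c0 : 0 < c.
  have [x Px xe] := interior0_lt P0 e0.
  by apply: lt_le_trans (support_fun_ge gP (Tnil e) Px); rewrite oppr_gt0.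
have ic : c \is a Num.int by apply: support_fun_lattice gP iS (Tnil e) pe.1.
have [s0 s0S es0] := gen_argmin gP (Tnil e).
have cE s : min_face P e s -> dot s e = - c.
  by move=> es; rewrite /c (support_fun_min es) opprK.
have [y [_ rE]] := (normal_fanE _ gP).1 re.
have ey : ncone P e `<=` ray e.
  by rewrite rE; apply: ncone_trans gP (Tnil y) _; rewrite -rE; apply: ray_mem.
pose A := [seq s <- S | `[< min_face P e s >]].
have Ae s : s \in A -> min_face P e s by rewrite mem_filter => /andP[/asboolP].
have [_ S'P _ /(_ (\sum_(s <- A) s) (Tnil _) (c^-1 *: e))[]] := gP'.
  move=> x Px; rewrite dotZr ler_pdivlMl // mulrN1.
  by rewrite -(cE _ es0); apply: es0.2.
move=> w wS'; rewrite !dot_sumr => hw.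
have wA s : s \in A -> dot w s = -1.
  have h1 u : u \in A -> 0 <= dot w u + 1.
    move=> uA; have := S'P _ wS' u (Ae u uA).1; rewrite dotC; lra.
  have h2 : \sum_(s <- A) (dot w s + 1) <= 0.
    have -> : \sum_(s <- A) (dot w s + 1) = \sum_(s <- A) dot w s -
        \sum_(s <- A) dot (c^-1 *: e) s.
      rewrite -sumrB; apply: eq_big_seq => u uA; congr (_ + _).
      by rewrite dotZl dotC (cE _ (Ae _ uA)) mulrN opprK mulVf ?gt_eqF.
    by rewrite subr_le0.
  by move=> sA; have := sumr_le0_mem h1 h2 sA; lra.
have ew : ncone P e w.
  apply/(nconeP _ gP (Tnil e)); split=> // s sS es; split; first exact: es.1.
  move=> x Px; rewrite dotC wA; first exact: S'P.
  by rewrite mem_filter sS andbT; apply/asboolP.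
have [t t0 wE] := ey _ ew.
have s0A : s0 \in A by rewrite mem_filter s0S andbT; apply/asboolP.
have tc : t * c = 1.
  have := wA s0 s0A; rewrite wE dotZl dotC cE // mulrN => /eqP.
  by rewrite eqr_opp => /eqP.
have eE : e = c *: w by rewrite wE scalerA mulrC tc scale1r.
have [k ck] : exists k : nat, c = k%:R by apply/natrP; rewrite natrEint ic ltW.
by rewrite ck in eE *; rewrite (pe.2 k w (iS' w wS') eE).
Qed.

Section NefPartition.

Variables (R : realType) (n r : nat) (Delta : set 'rV[R]_n).
Variables (Deltas : 'I_r -> set 'rV[R]_n) (phi : 'rV[R]_n -> R).

Hypothesis refl : reflexive_polytope Delta.
Hypothesis nef : nef_partition Delta Deltas.
Hypothesis phi_pl : piecewise_linear (normal_fan Delta) phi.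
Hypothesis phi1 : forall e, ray_generators (normal_fan Delta) e -> phi e = 1.

Let Tnil := @halfspaces_nil R n.
Let phi_ i := support_fun (Deltas i).
Let RG := ray_generators (normal_fan Delta).

Lemma nef_gens : exists SD : 'I_r -> seq 'rV[R]_n, forall i,
  [/\ generated (Deltas i) (SD i) [::], forall s, s \in SD i -> integral s
    & Deltas i = conv [set` SD i]].
Proof.
have [DE lD _] := nef; have [_ D0 _] := refl.
have : Delta 0 by apply: interior_subset D0.
rewrite DE => -[f [Df _]].
have /choice[SD hSD] : forall i, exists S, [/\ generated (Deltas i) S [::],
    forall s, s \in S -> integral s & Deltas i = conv [set` S]].
  by move=> i; apply: lattice_polytope_gen (lD i) _; exists (f i).
by exists SD.
Qed.

Lemma Delta_gen : exists S, generated Delta S [::] /\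
  forall s, s \in S -> integral s.
Proof.
have [lD D0 _] := refl.
have [|S [gD iS _]] := lattice_polytope_gen lD; last by exists S.
by exists 0; apply: interior_subset D0.
Qed.

Lemma nef_support_sum y : support_fun Delta y = \sum_i phi_ i y.
Proof.
have [DE _ _] := nef; have [SD hSD] := nef_gens.
rewrite DE; apply: support_fun_minkowski => i.
by have [gD _ _] := hSD i; apply: gen_min gD (Tnil y).
Qed.

Lemma nef_ray e : RG e -> exists j, forall i, phi_ i e = (i == j)%:R.
Proof.
move=> eR; have [_ _ hD] := nef.
apply: sum1_delta => [i|i|].
- by rewrite /phi_; case: (hD i e eR) => ->; rewrite ?ler01.
- by rewrite /phi_; case: (hD i e eR) => ->; rewrite ?rpred0 ?rpred1.
- by rewrite -nef_support_sum; apply: reflexive_ray_generator.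
Qed.

(** The cones are those of the normal fan of [Delta]; the functions [phi_ i] are
    linear on them because [Deltas i] is a Minkowski summand of [Delta]. *)
Lemma nef_cone y : exists s, [/\ forall e, e \in s -> RG e, hull s y,
  forall i, linear_on (hull s) (phi_ i) & linear_on (hull s) phi].
Proof.
have [S [gD iS]] := Delta_gen; have [DE _ _] := nef; have [_ D0 _] := refl.
have fD : is_fan (normal_fan Delta).
  by apply: (normal_fan_is_fan gD iS) => // z; apply: full_interior gD D0.
have FC : normal_fan Delta (ncone Delta y) by apply/(normal_fanE _ gD); exists y.
have [s [Cs is_ sF]] := fan_rays fD FC.
have /choice[g hg] : forall v, exists e, v \in s -> ray v = ray e /\ RG e.
  move=> v; have [vs|_] := boolP (v \in s); last by exists 0.
  have [e [pe ee]] := lattice_primitive (is_ v vs) (sF v vs).1.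
  by exists e => _; split=> //; split=> //; rewrite ee; apply: (sF v vs).2.
exists [seq g v | v <- s]; rewrite hull_map_ray => [|v /hg[]//]; rewrite -Cs.
split=> [_ /mapP[v /hg[_ ?] ->]//||i|]; [exact: ncone_refl| |exact: phi_pl].
have [SD hSD] := nef_gens; have [gDi _ _] := hSD i.
have [m hm] := support_fun_linear gDi (Tnil y); exists m => x; rewrite DE => hx.
apply: hm; apply: ncone_minkowski hx => j.
by have [gDj _ _] := hSD j; apply: gen_min gDj (Tnil y).
Qed.

(** Both sides are linear on a cone containing [y], so they are compared at its
    generators, without expanding [y] over them. *)
Lemma nef_le (a : 'I_r -> R) (w y : 'rV[R]_n) :
  (forall e, RG e -> \sum_i a i * phi_ i e <= dot w e) ->
  \sum_i a i * phi_ i y <= dot w y.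
Proof.
move=> h; have [s [sR sy slin _]] := nef_cone y; have [p hp] := choice slin.
have pE z : hull s z -> \sum_i a i * phi_ i z = dot (\sum_i a i *: p i) z.
  by move=> sz; rewrite dot_suml; apply: eq_bigr => i _; rewrite dotZl hp.
rewrite pE // -subr_ge0 -dotBl; move: y sy; apply: hull_sub => [|e es /=].
  split=> [|y z /= hy hz|t y t0 /= hy]; first by rewrite /= dot0r.
    by rewrite dotDr addr_ge0.
  by rewrite dotZr mulr_ge0.
by rewrite dotBl subr_ge0 -pE; [apply/h/sR|apply: hull_gen].
Qed.

Lemma nef_phi y : phi y = \sum_i phi_ i y.
Proof.
have [s [sR sy slin [q hq]]] := nef_cone y.
have [p hp] := linear_on_sum (index_enum _) slin.
rewrite hp // hq //; apply/eqP; rewrite -subr_eq0 -dotBl; apply/eqP.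
move: y sy; apply: (@hull_sub _ _ _ [set y | dot (q - p) y = 0]) => [|e es /=].
  split=> [|y z /= hy hz|t y t0 /= hy]; first by rewrite /= dot0r.
    by rewrite dotDr hy hz addr0.
  by rewrite dotZr hy mulr0.
have eh : hull s e by apply: hull_gen.
rewrite dotBl -hq // -hp // phi1; last exact: sR.
by rewrite -nef_support_sum (reflexive_ray_generator refl (sR e es)) subrr.
Qed.

Lemma nef_Delta0 i : Deltas i 0.
Proof.
have [SD hSD] := nef_gens; have [gD _ DE] := hSD i; rewrite DE.
apply: conv_separation => y; have [v vS vy] := gen_argmin gD (Tnil y).
exists v => //; rewrite dot0l -oppr_ge0 -(support_fun_min vy).
have := @nef_le (fun j => - (j == i)%:R) 0 y.
rewrite (bigD1 i) //= big1 ?addr0 => [|j /negbTE->]; last by rewrite oppr0 mul0r.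
rewrite eqxx mulN1r dot0l oppr_le0; apply=> e eR.
rewrite (bigD1 i) //= big1 ?addr0 => [|j /negbTE->]; last by rewrite oppr0 mul0r.
have [j ->] := nef_ray eR; rewrite eqxx mulN1r dot0l oppr_le0.
exact: ler0n.
Qed.

Lemma nef_RG_finite : exists l : seq 'rV[R]_n, forall e, RG e <-> e \in l.
Proof.
have [S [gD iS]] := Delta_gen.
have /choice[g hg] : forall C : set 'rV[R]_n, exists e, (exists2 e, RG e & C = ray e) ->
    RG e /\ C = ray e.
  move=> C; have [[e Re Ce]|nC] := pselect (exists2 e, RG e & C = ray e).
    by exists e.
  by exists 0.
have : finite_set RG.
  apply: (@sub_finite_set _ _ (g @` normal_fan Delta)); last first.
    by apply: finite_image; apply: normal_fan_finite gD.
  move=> e Re; exists (ray e); first by have [] := Re.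
  have [|Re' ee] := hg (ray e); first by exists e.
  have [t t0 gE] := ray_scale (esym ee).
  have := reflexive_ray_generator refl Re'; have := reflexive_ray_generator refl Re.
  have [s _ es] := gen_argmin gD (Tnil e); rewrite (support_fun_min es).
  have ts : min_face Delta (t *: e) s.
    by split; [exact: es.1|move=> x /es.2; rewrite !dotZr; apply: ler_wpM2l].
  rewrite {1}gE (support_fun_min ts) dotZr -mulrN => ->.
  by rewrite mulr1 => t1; rewrite gE t1 scale1r.
by move=> /finite_seqP[l lE]; exists l => e; rewrite lE.
Qed.

(** A point satisfying the inequalities on the right is compared with the polytope
    on the left through linear forms, by separation.  On either side the
    comparison reduces to ray generators [e], each of which has [phi_ j e = 1] for
    exactly one [j] and so belongs to exactly one of the polytopes
    [nablas Delta Deltas j]. *)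
Lemma nef_duality : exists GD GN, [/\ pieces Deltas GD,
  pieces (nablas Delta Deltas) GN, forall y, phi y = \sum_i phi_ i y,
  forall j x, Deltas j x <->
    forall i, support_fun (nablas Delta Deltas i) x <= (i == j)%:R
  & forall j y, nablas Delta Deltas j y <-> forall i, phi_ i y <= (i == j)%:R].
Proof.
have [SD hSD] := nef_gens; have [l lRG] := nef_RG_finite.
pose GN i := 0 :: [seq e <- l | phi_ i e == 1].
have NE i : nablas Delta Deltas i = conv [set` GN i].
  rewrite /nablas; congr conv; apply/seteqP; split=> e /=.
    case=> [->|[/lRG el e1]]; first by rewrite mem_head.
    by rewrite inE mem_filter el andbT -/(phi_ i) /phi_ e1 eqxx orbT.
  rewrite inE mem_filter => /predU1P[->|/andP[/eqP e1 /lRG el]]; first by left.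
  by right.
have iRG e : RG e -> integral e by move=> [[]].
have pN : pieces (nablas Delta Deltas) GN.
  move=> i; rewrite NE; split.
  - split=> //; [by move=> s sS; apply: conv_gen|by move=> y _ x; apply: conv_argmin].
  - move=> s; rewrite inE mem_filter => /predU1P[->|/andP[_ /lRG/iRG//]].
    exact: lattice0.
  - by apply: conv_gen; rewrite /= mem_head.
have Ngen j e : e \in GN j -> forall i, phi_ i e <= (i == j)%:R.
  rewrite inE mem_filter => /predU1P[-> i|/andP[/eqP e1 /lRG el] i].
    have [gD _ _] := hSD i; have [s _ us] := gen_argmin gD (Tnil 0).
    by rewrite /phi_ (support_fun_min us) dot0r oppr0 ler0n.
  have [k ek] := nef_ray el; move: e1; rewrite !ek.
  case: (eqVneq j k) => [->//|_] /eqP; by rewrite eq_sym oner_eq0.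
have pD : pieces Deltas SD.
  by move=> i; have [gD iD _] := hSD i; split=> //; apply: nef_Delta0.
exists SD, GN; split=> //.
- exact: nef_phi.
- move=> j x; split=> [Dx i|h].
    have [gN _ _] := pN i; have [e eN xe] := gen_argmin gN (Tnil x).
    have [gD _ _] := hSD j; rewrite (support_fun_min xe) dotC.
    apply: le_trans (support_fun_ge gD (Tnil e) Dx) _.
    by rewrite eq_sym; apply: Ngen.
  have [gD _ DE] := hSD j; rewrite DE; apply: conv_separation => y.
  have [v vS vy] := gen_argmin gD (Tnil y); exists v => //.
  rewrite -[leLHS]opprK -(support_fun_min vy).
  have := @nef_le (fun i => - (i == j)%:R) x y.
  rewrite (bigD1 j) //= big1 ?addr0 => [|i /negbTE->]; last by rewrite oppr0 mul0r.
  rewrite eqxx mulN1r; apply=> e eR.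
  rewrite (bigD1 j) //= big1 ?addr0 => [|i /negbTE->]; last by rewrite oppr0 mul0r.
  rewrite eqxx mulN1r; have [k ek] := nef_ray eR; rewrite ek lerNl dotC.
  have [gN _ _] := pN k; have [_ SN _ _] := gN; have eN : e \in GN k.
    by rewrite inE mem_filter ek !eqxx /= orbC; have /lRG -> := eR.
  by have := le_trans (support_fun_ge gN (Tnil x) (SN _ eN)) (h k); rewrite (eq_sym k).
- move=> j y; split=> [|h].
    rewrite NE => hy i; have [gD _ _] := hSD i.
    have [s sS ys] := gen_argmin gD (Tnil y).
    rewrite /phi_ (support_fun_min ys) lerNl dotC; apply: conv_dot_ge hy => e eN.
    rewrite lerNl dotC; apply: le_trans (Ngen _ _ eN i).
    by apply: support_fun_ge gD (Tnil e) _; exact: ys.1.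
  rewrite NE; apply: conv_separation => x.
  have /choice[v hv] : forall k, exists v, v \in GN k /\
      min_face (nablas Delta Deltas k) x v.
    move=> k; have [gN _ _] := pN k; have [v vN xv] := gen_argmin gN (Tnil x).
    by exists v.
  exists (v j); first by have [] := hv j.
  have v0 k : dot (v k) x <= 0.
    by rewrite -(dot0l x); apply: (hv k).2.2; have [] := pN k.
  rewrite (dotC y); apply: le_trans (@nef_le (fun k => dot (v k) x) x y _) => [|e eR].
    rewrite (bigD1 j) //= -[leLHS]addr0; apply: lerD.
      have := h j; rewrite eqxx => yj.
      by rewrite -[leLHS]mulr1 ler_wnM2l.
    apply: sumr_ge0 => i ij; have := h i; rewrite (negbTE ij) => yi.
    have [gD _ D0] := pD i.
    have -> : phi_ i y = 0.
      by apply/eqP; rewrite eq_le yi; apply: support_fun_ge0 gD D0 (Tnil y).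
    by rewrite mulr0.
  have [k ek] := nef_ray eR; rewrite (bigD1 k) //= big1 ?addr0 => [|i ik]; last first.
    by rewrite ek (negbTE ik) mulr0.
  rewrite ek eqxx mulr1 (dotC x); apply: (hv k).2.2.
  have [[_ SN _ _] _ _] := pN k; apply: SN.
  by rewrite inE mem_filter ek !eqxx /= orbC; have /lRG -> := eR.
Qed.

End NefPartition.

(** * The dual good data *)

Lemma support_funZ (R : realType) (n : nat) (P : set 'rV[R]_n)
    (S T : seq 'rV[R]_n) (y : 'rV[R]_n) (t : R) :
  generated P S T -> halfspaces T y -> 0 <= t ->
  support_fun P (t *: y) = t * support_fun P y.
Proof.
move=> gP Ty t0; have [s _ ys] := gen_argmin gP Ty; rewrite (support_fun_min ys).
rewrite (@support_fun_min _ _ _ _ s) ?dotZr ?mulrN //.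
by split; [exact: ys.1|move=> x /ys.2; rewrite !dotZr; apply: ler_wpM2l].
Qed.

Section GoodDual.

Variables (R : realType) (n r : nat).
Variables (Delta : set 'rV[R]_n) (Deltas : 'I_r -> set 'rV[R]_n).
Variable phi : 'rV[R]_n -> R.
Variables (Sigma' cSigma' : set (set 'rV[R]_n)) (h ch : 'rV[R]_n -> R).
Variables (tSigma' : set (set 'rV[R]_(n + 1))) (th : 'rV[R]_(n + 1) -> R).

Let Sigma := normal_fan Delta.
Let nabla_ := nablas Delta Deltas.
Let nabla := minkowski_sum nabla_.
Let cSigma := normal_fan nabla.
Let cphi := fun x => \sum_(i < r) support_fun (nabla_ i) x.
Let h' := h \- phi.
Let ch' := ch \- cphi.
Let tDelta := minkowski_sum (fun i => epigraph (Deltas i) ch').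
Let th' := th \- support_fun tDelta.
Let tnabla := epigraph nabla h'.
Let tnabla' := epigraph (newton ch') (fun y => th' (pt y 1)).
Let tsum := [set x + y | x in tnabla & y in tnabla'].

Hypothesis r0 : (0 < r)%N.
Hypothesis refl : reflexive_polytope Delta.
Hypothesis nef : nef_partition Delta Deltas.
Hypothesis crepS : crepant_subdivision (polar Delta) Sigma' Sigma.
Hypothesis crepcS : crepant_subdivision (polar nabla) cSigma' cSigma.
Hypothesis ch_pl : integral_piecewise_linear cSigma' ch.
Hypothesis ch_strict : strictly_convex cSigma' ch.
Hypothesis ch'_convex : convex_on setT ch'.
Hypothesis good_th : good tDelta (newton ch') Sigma' h tSigma' th.

Let Tnil := @halfspaces_nil R n.
Let phi_ i := support_fun (Deltas i).
Let omega_ i := support_fun (nabla_ i).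
Let tphi_ i := support_fun (epigraph (Deltas i) ch').
Let D' := @halfspaces R (n + 1) (upward R n).

Variables GD GN : 'I_r -> seq 'rV[R]_n.
Hypothesis pD : pieces Deltas GD.
Hypothesis pN : pieces nabla_ GN.
Hypothesis phiE : forall y, phi y = \sum_i phi_ i y.
Hypothesis DW : forall j x, Deltas j x <-> forall i, omega_ i x <= (i == j)%:R.
Hypothesis NW : forall j y, nabla_ j y <-> forall i, phi_ i y <= (i == j)%:R.

Variable SD : 'I_r -> seq 'rV[R]_(n + 1).
Hypothesis gen_tD : forall i, generated (epigraph (Deltas i) ch') (SD i) (upward R n).
Hypothesis int_tD : forall i s, s \in SD i -> integral s.

Lemma D'P (x : 'rV[R]_n) (l : R) : 0 <= l -> D' (pt x l).
Proof. by move=> ?; apply/halfspaces_up. Qed.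

Lemma tphi_min i z : D' z -> exists s, min_face (epigraph (Deltas i) ch') z s.
Proof. exact: gen_min (gen_tD i). Qed.

Lemma tDelta_gen : exists S, generated tDelta S (upward R n) /\
  forall s, s \in S -> integral s.
Proof. exact: gen_minkowski r0 gen_tD int_tD. Qed.

Lemma tphi_sum z : D' z -> support_fun tDelta z = \sum_i tphi_ i z.
Proof. by move=> Dz; apply: support_fun_minkowski => i; apply: tphi_min. Qed.

Lemma phi_ge0 i x : 0 <= phi_ i x.
Proof. by have [gD _ D0] := pD i; apply: support_fun_ge0 gD D0 (Tnil x). Qed.

Lemma cSigma'_support : fan_support cSigma' = setT.
Proof.
have [[_ -> _] _] := crepcS; have [S [gN _]] : exists S, generated nabla S [::] /\
    forall s, s \in S -> integral s.
  by apply: (gen_minkowski (S_ := GN)) => // i; have [] := pN i.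
by rewrite (normal_fan_support gN); apply/seteqP; split.
Qed.

Lemma ch'_pl : piecewise_linear cSigma' ch'.
Proof.
move=> C FC; apply: linear_onB; first exact: ch_pl.1.
by apply: linear_on_sum; apply: crepant_linear r0 pN crepcS.1 FC.
Qed.

Lemma ch'0 : ch' 0 = 0.
Proof.
have : fan_support cSigma' 0 by rewrite cSigma'_support.
move=> [C FC C0]; have [m hm] := ch'_pl FC.
by rewrite hm // dot0r.
Qed.

Lemma tSigma'_fan : is_fan tSigma'.
Proof. by have [[[]]] := good_th. Qed.

Lemma tSigma'_support : fan_support tSigma' = D'.
Proof.
have [S [gD _]] := tDelta_gen; have [[[_ -> _] _ _] _] := good_th.
exact: normal_fan_support gD.
Qed.

Lemma tphi_linear C i : tSigma' C -> linear_on C (tphi_ i).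
Proof.
move=> FC; have [S [gD _]] := tDelta_gen; have [[subF _ _] _] := good_th.
have [y Dy Cy] := subdivision_ncone gD subF FC.
have [m hm] := support_fun_linear (gen_tD i) Dy; exists m => x /Cy hx.
by apply: hm; apply: ncone_minkowski hx => j; apply: tphi_min.
Qed.

Lemma th'_pl : piecewise_linear tSigma' th'.
Proof.
move=> C FC; have [_ [thi _ _ _]] := good_th.
apply: linear_onB; first exact: thi.1.
have [m hm] := linear_on_sum (index_enum _) (fun i => tphi_linear i FC).
exists m => x Cx; rewrite tphi_sum ?hm // -tSigma'_support.
by exists C.
Qed.

Lemma th'_convex : convex_on D' th'.
Proof. by have [_ [_ _ _]] := good_th; rewrite tSigma'_support. Qed.

Lemma th'_lattice z : D' z -> integral z -> th' z \is a Num.int.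
Proof.
move=> Dz iz; have [S [gD iS]] := tDelta_gen; have [_ [thi _ _ _]] := good_th.
apply: rpredB; last exact: support_fun_lattice gD iS Dz iz.
by apply: thi.2 => //; rewrite tSigma'_support.
Qed.

Lemma tphi_horizontal i y : tphi_ i (pt y 0) = phi_ i y.
Proof.
have [gD _ _] := pD i; have [s _ ys] := gen_argmin gD (Tnil y).
rewrite /phi_ (support_fun_min ys).
rewrite /tphi_ (@support_fun_min _ _ _ _ (pt s (ch' s))) ?dot_pt ?mulr0 ?addr0 //.
split; first by exists s, (ch' s); split=> //; exact: ys.1.
by move=> _ [m [l [Dm _ ->]]]; rewrite !dot_pt !mulr0 !addr0; apply: ys.2.
Qed.

(** So [h'] is the recession function of the convex function [th' (pt _ 1)]: the
    value of the latter at [n1 + n2] is at most [h' n1 + th' (pt n2 1)]. *)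
Lemma th'_horizontal y : th' (pt y 0) = h' y.
Proof.
have [_ [_ thE _ _]] := good_th.
rewrite /th' /= thE tphi_sum; last exact: D'P.
rewrite /h' /= phiE; congr (_ - _).
by apply: eq_bigr => i _; rewrite tphi_horizontal.
Qed.

Lemma th'Z t z : D' z -> 0 <= t -> th' (t *: z) = t * th' z.
Proof.
rewrite -{1}tSigma'_support => -[C FC Cz] t0; have [m hm] := th'_pl FC.
have [_ rF _ _] := tSigma'_fan; have [[s [_ Cs]] _] := rF C FC.
rewrite !hm ?dotZr // {1}Cs; have [_ _ HZ] := hull_cone s; apply: HZ => //.
by rewrite /hull -Cs.
Qed.

Lemma tphi_ge0 i z : D' z -> 0 <= tphi_ i z.
Proof.
move=> Dz; apply: (support_fun_ge0 (gen_tD i)) => //.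
exists 0, 0; rewrite pt0 ch'0; split=> //.
by have [_ _] := pD i.
Qed.

(** The bound is the maximum of [cphi] on [Deltas i], by which the inequalities
    of [newton ch] are weaker than those of [newton ch']. *)
Lemma tphi_le1 i x : newton ch x -> tphi_ i (pt x 1) <= 1.
Proof.
move=> hx; have [s [[m [l [Dm ml ->]]] us]] := tphi_min i (D'P x ler01).
rewrite /tphi_ (support_fun_min (conj (ex_intro _ m (ex_intro _ l (And3 Dm ml erefl))) us)).
rewrite dot_pt mulr1; have := hx m; rewrite (dotC x).
have : cphi m <= 1.
  apply: (@le_trans _ _ (\sum_j (j == i)%:R)).
    by apply: ler_sum => j _; apply: (DW i m).1.
  by rewrite (bigD1 i) //= eqxx big1 ?addr0 // => j /negbTE->.
move: ml; rewrite /ch' /=; lra.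
Qed.

Lemma tphi_newton i x : newton ch' x -> tphi_ i (pt x 1) <= 0.
Proof.
move=> hx; have [s [[m [l [Dm ml ->]]] us]] := tphi_min i (D'P x ler01).
rewrite /tphi_ (support_fun_min (conj (ex_intro _ m (ex_intro _ l (And3 Dm ml erefl))) us)).
by rewrite dot_pt mulr1; have := hx m; rewrite (dotC x); lra.
Qed.

(** ** The decomposition of the cones of the good fan *)

Lemma vertical_rays : exists V : seq 'rV[R]_n,
  (forall v, v \in V -> integral v /\ newton ch' v) /\
  forall C, tSigma' C -> is_ray C -> ~ (C `<=` [set pt y 0 | y in setT]) ->
    exists2 v, v \in V & C = ray (pt v 1).
Proof.
have [[_ _ vert] _] := good_th.
have /choice[g hg] : forall C : set 'rV[R]_(n + 1), exists q : 'rV[R]_n,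
    tSigma' C -> is_ray C -> ~ (C `<=` [set pt y 0 | y in setT]) ->
    [/\ newton ch' q, primitive (pt q 1) & C = ray (pt q 1)].
  move=> C; have [[FC [rC nC]]|nF] := pselect (tSigma' C /\ is_ray C /\
      ~ (C `<=` [set pt y 0 | y in setT])).
    by have [q hq] := vert C FC rC nC; exists q.
  by exists 0 => FC rC nC; case: nF.
have [/finite_seqP[l Fl] _ _ _] := tSigma'_fan.
pose isv (C : set 'rV[R]_(n + 1)) := is_ray C /\ ~ (C `<=` [set pt y 0 | y in setT]).
exists [seq g C | C <- l & `[< isv C >]]; split.
  move=> _ /mapP[C + ->]; rewrite mem_filter => /andP[/asboolP[rC nC] Cl].
  have [|//|//|nq pq _] := hg C; first by rewrite Fl.
  by split=> //; have [/lattice_pt[]] := pq.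
move=> C FC rC nC; have [nq pq ->] := hg C FC rC nC.
exists (g C) => //; apply/map_f; rewrite mem_filter; apply/andP.
by split; [apply/asboolP|move: FC; rewrite Fl].
Qed.

Lemma horizontal_ray w : tSigma' (ray (pt w 0)) -> w != 0 ->
  exists j, forall i, i != j -> phi_ i w = 0.
Proof.
move=> Fw w0; have [[_ slice _] _] := good_th; have [DE _ _] := nef.
have rw : Sigma' (ray w).
  rewrite -slice; exists (ray (pt w 0)) => //; apply/seteqP; split=> y /=.
    by move=> [t t0]; rewrite ptZ => /pt_inj[-> _]; exists t.
  by move=> [t t0 ->]; exists t; rewrite // ptZ mulr0.
have [||u [j [wu _ uj]]] := @crepant_ray _ _ _ _ _ Sigma' (ray w) r0 pD _ rw.
- by rewrite -DE.
- by exists w.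
have [t t0 ->] := ray_scale wu; exists j => i ij; have [gD _ _] := pD i.
by rewrite /phi_ (support_funZ gD (Tnil u) t0) uj (negbTE ij) mulr0.
Qed.

Variable V : seq 'rV[R]_n.
Hypothesis intV : forall v, v \in V -> integral v /\ newton ch' v.
Hypothesis raysV : forall C, tSigma' C -> is_ray C ->
  ~ (C `<=` [set pt y 0 | y in setT]) -> exists2 v, v \in V & C = ray (pt v 1).

Let verts (C : set 'rV[R]_(n + 1)) :=
  [seq p <- [seq pt v 1 | v <- V] | `[< C p >]].

Lemma verts_sub C : convex_cone C -> hull (verts C) `<=` C.
Proof.
by move=> CC; apply: hull_sub => // v; rewrite mem_filter => /andP[/asboolP].
Qed.

(** The rays of a cone of the good fan are spanned either by [(v, 1)] with [v] in
    [newton ch'], or by a horizontal vector at which a single [phi_ j] is nonzero. *)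
Lemma decomposition z : D' z -> exists C v (w : 'I_r -> 'rV[R]_n),
  [/\ tSigma' C, C z, z = v + \sum_i pt (w i) 0, hull (verts C) v
    & forall i, C (pt (w i) 0) /\ forall j, j != i -> phi_ j (w i) = 0].
Proof.
rewrite -tSigma'_support => -[C FC Cz].
suff [v [w [zE hv hw]]] : exists v (w : 'I_r -> 'rV[R]_n),
    [/\ z = v + \sum_i pt (w i) 0, hull (verts C) v
      & forall i, C (pt (w i) 0) /\ forall j, j != i -> phi_ j (w i) = 0].
  by exists C, v, w.
have [s [Cs _ sF]] := fan_rays tSigma'_fan FC.
have CC : convex_cone C by rewrite Cs; apply: hull_cone.
have [C0 CD CZ] := CC; have [H0 HD HZ] := hull_cone (verts C).
have phi00 j : phi_ j 0 = 0.
  have [gD _ _] := pD j.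
  by rewrite -(scale0r 0) /phi_ (support_funZ gD (Tnil 0)) // mul0r.
have sumpt0 : \sum_(i < r) pt (0 : 'rV[R]_n) (0 : R) = 0 by rewrite pt0 big1.
move: Cz; rewrite {1}Cs; apply: (@hull_sub _ _ s [set z | exists v w,
    [/\ z = v + \sum_i pt (w i) 0, hull (verts C) v
      & forall i, C (pt (w i) 0) /\ forall j, j != i -> phi_ j (w i) = 0]]).
- split.
  + exists 0, (fun=> 0); split=> //; first by rewrite sumpt0 addr0.
    by rewrite pt0.
  + move=> _ _ [v [w [-> hv hw]]] [v' [w' [-> hv' hw']]].
    exists (v + v'), (fun i => w i + w' i); split.
    * rewrite addrACA -big_split; congr (_ + _); apply: eq_bigr => i _.
      by rewrite /= ptD addr0.
    * exact: HD.
    * move=> i; have [Cw pw] := hw i; have [Cw' pw'] := hw' i; split.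
        by rewrite -[X in pt _ X](addr0 0) -ptD; apply: CD.
      move=> j ji; apply/eqP; rewrite eq_le phi_ge0 andbT.
      have [gD _ _] := pD j.
      by apply: le_trans (support_funD gD (Tnil _) (Tnil _)) _;
        rewrite -!/(phi_ j _) pw ?pw' ?addr0.
  + move=> t _ t0 [v [w [-> hv hw]]]; exists (t *: v), (fun i => t *: w i); split.
    * rewrite scalerDr scaler_sumr; congr (_ + _); apply: eq_bigr => i _.
      by rewrite ptZ mulr0.
    * exact: HZ.
    * move=> i; have [Cw pw] := hw i; split.
        by rewrite -[X in pt _ X](mulr0 t) -ptZ; apply: CZ.
      move=> j ji; have [gD _ _] := pD j.
      by rewrite /phi_ (support_funZ gD (Tnil _) t0) -/(phi_ j _) pw ?mulr0.
- move=> v vs; have [v0 Fv] := sF v vs.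
  have Cv : C v by rewrite Cs; apply: hull_gen.
  have [hor|ver] := pselect (ray v `<=` [set pt y 0 | y in setT]).
    have [w _ wv] := hor v (ray_mem v); rewrite -wv in v0 Fv Cv *.
    have w0 : w != 0 by apply: contraNneq v0 => ->; rewrite pt0.
    have [j hj] := horizontal_ray Fv w0.
    exists 0, (fun i => if i == j then w else 0); split=> //.
      rewrite add0r (bigD1 j) //= eqxx big1 ?addr0 // => i /negbTE->.
      by rewrite pt0.
    move=> i; case: eqP => [->|_]; first by split=> // k; apply: hj.
    by rewrite pt0; split.
  have [|q qV vq] := raysV Fv _ ver; first by exists v.
  exists v, (fun=> 0); split; [by rewrite sumpt0 addr0| |by rewrite pt0].
  have [t t0 ->] := ray_scale vq; apply: HZ => //; apply: hull_gen.
  rewrite mem_filter (map_f (fun v => pt v 1)) // andbT; apply/asboolP.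
  by have [t' t'0 ->] := ray_scale (esym vq); apply: CZ.
Qed.

Lemma decomposition_phi i (C : set 'rV[R]_(n + 1)) z v (w : 'I_r -> 'rV[R]_n) :
  tSigma' C -> C z -> z = v + \sum_i pt (w i) 0 -> C v ->
  (forall i, C (pt (w i) 0) /\ forall j, j != i -> phi_ j (w i) = 0) ->
  tphi_ i z = tphi_ i v + phi_ i (w i).
Proof.
move=> FC Cz zE Cv hw; have [m hm] := tphi_linear i FC.
have CC : convex_cone C.
  by have [_ rF _ _] := tSigma'_fan; have [[s [_ ->]] _] := rF C FC; apply: hull_cone.
rewrite !hm // zE dotDr; congr (_ + _); rewrite dot_sumr (bigD1 i) //= big1.
  by rewrite addr0 -tphi_horizontal hm //; have [] := hw i.
move=> j ji; have [Cw pw] := hw j.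
by rewrite -hm // tphi_horizontal pw // eq_sym.
Qed.

Lemma phi_eq0 w : (forall j, phi_ j w = 0) -> w = 0.
Proof.
move=> w0; apply/eqP/negPn/negP => wn0; have [DE _ _] := nef.
have [_ D0 _] := refl; have [x Dx xw] := interior0_lt D0 wn0.
have [S [gD _]] := Delta_gen refl.
have := support_fun_ge gD (Tnil w) Dx.
have -> : support_fun Delta w = 0.
  by rewrite DE (support_fun_pieces w pD) big1 // => j _; apply: w0.
lra.
Qed.

Lemma cone_newton C v : hull (verts C) v ->
  exists x l, v = pt x l /\ forall m, - (l * ch' m) <= dot x m.
Proof.
move: v; apply: hull_sub.
  split=> [|_ _ [x [l [-> hx]]] [y [k [-> hy]]]|t _ t0 [x [l [-> hx]]]].
  - by exists 0, 0; rewrite pt0; split=> // m; rewrite mul0r dot0l oppr0.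
  - exists (x + y), (l + k); split; first exact: ptD.
    by move=> m; rewrite dotDl mulrDl opprD lerD.
  - exists (t *: x), (t * l); split; first exact: ptZ.
    by move=> m; rewrite dotZl -mulrA -mulrN ler_wpM2l.
move=> p; rewrite mem_filter => /andP[_ /mapP[v vV ->]].
by exists v, 1; split=> // m; rewrite mul1r; apply: (intV vV).2.
Qed.

Lemma D'_of C z : tSigma' C -> C z -> D' z.
Proof. by move=> FC Cz; rewrite -tSigma'_support; exists C. Qed.

(** Over [newton ch] the lower boundary of [tsum] is the graph of [th']: the
    decomposition of [(x, 1)] has its horizontal part in [nabla], since
    [tphi_ i] is at most [1] there. *)
Lemma tsum_graph x : newton ch x -> tsum (pt x (th' (pt x 1))).
Proof.
move=> hx; have [C [v [w [FC Cz zE hv hw]]]] := decomposition (D'P x ler01).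
have CC : convex_cone C.
  by have [_ rF _ _] := tSigma'_fan; have [[s [_ ->]] _] := rF C FC; apply: hull_cone.
have Cv := verts_sub CC hv; have [y [l [vE hy]]] := cone_newton hv.
have wN i : nabla_ i (w i).
  apply/NW => j; case: (eqVneq j i) => [->|/(hw i).2->//].
  have := decomposition_phi i FC Cz zE Cv hw; have := tphi_le1 i hx.
  have := tphi_ge0 i (D'_of FC Cv); rewrite /=; lra.
have [xE lE] : x = y + \sum_i w i /\ l = 1.
  by move: zE; rewrite vE pt_sum big1_eq ptD addr0 => /pt_inj[-> ->].
have hor : C (pt (\sum_i w i) 0).
  have -> : pt (\sum_i w i) 0 = \sum_i pt (w i) 0 by rewrite pt_sum big1_eq.
  by apply: cone_sum => // i _; have [] := hw i.
have [m hm] := th'_pl FC.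
exists (pt (\sum_i w i) (h' (\sum_i w i))).
  by exists (\sum_i w i), (h' (\sum_i w i)); split=> //; exists w.
exists (pt y (th' (pt y 1))).
  exists y, (th' (pt y 1)); split=> // m'.
  by have := hy m'; rewrite lE mul1r.
have {}vE : v = pt y 1 by rewrite vE lE.
rewrite ptD (addrC (\sum_i w i)) -xE; congr pt.
rewrite -th'_horizontal -vE !hm // -dotDr; congr dot.
by rewrite zE pt_sum big1_eq addrC.
Qed.

Lemma tsum_below p : tsum p ->
  exists x l, [/\ p = pt x l, newton ch x & th' (pt x 1) <= l].
Proof.
move=> [_ [n1 [l1 [[w [wN n1E]] hl1 ->]]] [_ [n2 [l2 [hn2 hl2 ->]]] <-]].
exists (n1 + n2), (l1 + l2); split; first exact: ptD.
  move=> y; rewrite dotDl; have := hn2 y; rewrite /ch' /=.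
  suff : - cphi y <= dot n1 y by lra.
  rewrite n1E dot_suml -sumrN; apply: ler_sum => i _.
  have [gN _ _] := pN i; rewrite lerNl.
  by apply: support_fun_ge gN (Tnil y) (wN i).
have := th'_convex (D'P n1 (lexx 0)) (D'P n2 ler01).
rewrite ptD add0r th'_horizontal => /le_trans; apply.
exact: lerD.
Qed.

Lemma gen_tnabla' : exists S, generated tnabla' S (upward R n) /\
  forall s, s \in S -> integral s.
Proof.
exists [seq pt v (th' (pt v 1)) | v <- V]; split; last first.
  move=> _ /mapP[v /intV[iv _] ->]; apply/lattice_pt; split=> //.
  apply: th'_lattice; first exact: D'P.
  by apply/lattice_pt; rewrite rpred1.
have V0 : V != [::].
  apply/eqP => V0; have [C [v [w [_ _ zE hv _]]]] := decomposition (D'P 0 ler01).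
  have v0 : v = 0.
    move: hv; rewrite /verts V0 /=; apply: (@hull_sub _ _ [::] [set v | v = 0]) => //.
    by split=> //= [x y -> ->|t x _ ->]; rewrite ?addr0 ?scaler0.
  move: zE; rewrite v0 add0r pt_sum big1_eq => /pt_inj[_ /eqP].
  by rewrite oner_eq0.
split.
- by case: V V0.
- move=> _ /mapP[v vV ->]; exists v, (th' (pt v 1)); split=> //.
  exact: (intV vV).2.
- by move=> *; exact: epigraph_up.
move=> y; have [a [b ->]] := pt_surj y => /halfspaces_up b0 _ [x [l [hx xl ->]]].
have [v0 v0V hv0] := seq_argmin (fun v => dot (pt v (th' (pt v 1))) (pt a b)) V0.
exists (pt v0 (th' (pt v0 1))); first exact: map_f.
set mu := dot _ _; rewrite dot_pt.
have [C [v [w [FC Cz zE hv hw]]]] := decomposition (D'P x ler01).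
have CC : convex_cone C.
  by have [_ rF _ _] := tSigma'_fan; have [[s [_ ->]] _] := rF C FC; apply: hull_cone.
have Cv := verts_sub CC hv.
(* over newton ch' the horizontal part of the decomposition vanishes *)
have w0 i : w i = 0.
  apply: phi_eq0 => j; case: (eqVneq j i) => [->|/(hw i).2//].
  have := decomposition_phi i FC Cz zE Cv hw; have := tphi_newton i hx.
  have := tphi_ge0 i (D'_of FC Cv); have := phi_ge0 i (w i) => h1 h2 h3 h4.
  by apply/eqP; rewrite eq_le h1 andbT; lra.
have {}zE : pt x 1 = v by rewrite zE big1 ?addr0 // => i _; rewrite w0 pt0.
have [m hm] := th'_pl FC.
suff : 0 <= dot (pt a (- mu) + b *: m) (pt x 1).
  rewrite dotDl dotZl -hm // dot_pt mulr1 (dotC a) => hmu.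
  have : b * th' (pt x 1) <= b * l by apply: ler_wpM2l.
  by rewrite (mulrC l); lra.
rewrite zE; apply: (@hull_sub _ _ (verts C)
    [set u | 0 <= dot (pt a (- mu) + b *: m) u]) hv => [|u].
  split=> [|p q /= hp hq|t p t0 /= hp]; first by rewrite /= dot0r.
    by rewrite dotDr addr_ge0.
  by rewrite dotZr mulr_ge0.
rewrite mem_filter => /andP[/asboolP Cu /mapP[u' u'V uE]].
rewrite uE in Cu *; rewrite /= dotDl dotZl -hm // dot_pt mulr1 (dotC a).
have := hv0 u' u'V; rewrite -/mu dot_pt (mulrC b); lra.
Qed.

Lemma tsum_min_horizontal y : exists p,
  min_face tsum (pt y 0) p /\ dot p (pt y 0) = - ch y.
Proof.
have /choice[e he] : forall i, exists e, min_face (nabla_ i) y e.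
  by move=> i; have [gN _ _] := pN i; apply: gen_min gN (Tnil y).
have [[fcS _ _] _] := crepcS.
(* the opposite of a slope of [ch'] at [y] minimizes [y] over [newton ch'] *)
have [|||||q [C [_ Cy _ hq qle]]] := @convex_slope _ _ cSigma' ch' y fcS.
- by rewrite cSigma'_support; split.
- by move=> w; left; rewrite cSigma'_support.
- exact: ch'_pl.
- by rewrite cSigma'_support.
- by rewrite cSigma'_support.
pose n1 := \sum_i e i; pose p := pt n1 (h' n1) + pt (- q) (th' (pt (- q) 1)).
have pE : dot p (pt y 0) = - ch y.
  rewrite /p ptD dot_pt mulr0 addr0 dotDl dotNl -hq // dot_suml.
  rewrite (eq_bigr (fun i => - omega_ i y)) => [|i _]; last first.
    by rewrite /omega_ (support_fun_min (he i)) opprK.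
  by rewrite sumrN /ch' /cphi /= opprB addKr.
exists p; split=> //; split; last first.
  move=> _ /tsum_below[x [l [-> hx _]]].
  by rewrite pE dot_pt mulr0 addr0; apply: hx.
exists (pt n1 (h' n1)).
  exists n1, (h' n1); split=> //; exists e; split=> // i.
  by have [] := he i.
exists (pt (- q) (th' (pt (- q) 1))) => //.
exists (- q), (th' (pt (- q) 1)); split=> // x.
by rewrite dotNl lerN2; apply: qle; rewrite cSigma'_support.
Qed.

Lemma tsum_horizontal y : support_fun tsum (pt y 0) = ch y.
Proof.
by have [p [yp pE]] := tsum_min_horizontal y; rewrite (support_fun_min yp) pE opprK.
Qed.

Variables Stn Stn' : seq 'rV[R]_(n + 1).
Hypothesis gen_tn : generated tnabla Stn (upward R n).
Hypothesis int_tn : forall s, s \in Stn -> integral s.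
Hypothesis gen_tn' : generated tnabla' Stn' (upward R n).
Hypothesis int_tn' : forall s, s \in Stn' -> integral s.

Let S := [seq x + y | x <- Stn, y <- Stn'].

Lemma gen_tsum : generated tsum S (upward R n).
Proof. exact: gen_add. Qed.

Lemma int_tsum s : s \in S -> integral s.
Proof.
move=> /allpairsP[[a b]/= [aS bS ->]]; apply: latticeD;
  [exact: int_tn|exact: int_tn'].
Qed.

Let base : set 'rV[R]_n := [set x | exists l, tsum (pt x l)].

Lemma min_face_base y x : min_face base y x <->
  exists l, min_face tsum (pt y 0) (pt x l).
Proof.
split=> [[[l xl] hx]|[l [xl hx]]].
  exists l; split=> // p tp; have [x' [l' [pE _ _]]] := tsum_below tp.
  by rewrite pE !dot_pt !mulr0 !addr0; apply: hx; exists l'; rewrite -pE.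
split; first by exists l.
by move=> x' [l' /hx]; rewrite !dot_pt !mulr0 !addr0.
Qed.

Lemma gen_base : generated base [seq lsubmx s | s <- S] [::].
Proof.
have [S0 SP _ hS] := gen_tsum; split=> //.
- by case: S S0.
- move=> _ /mapP[s /SP sP ->]; have [x [l [sE _ _]]] := tsum_below sP.
  by exists l; rewrite sE row_mxKl -sE.
- move=> y _ x [l xl]; have [s sS sx] := hS _ (D'P y (lexx 0)) _ xl.
  have [x' [l' [sE _ _]]] := tsum_below (SP s sS).
  exists (lsubmx s); first exact: map_f.
  by move: sx; rewrite sE row_mxKl !dot_pt !mulr0 !addr0.
Qed.

Lemma support_base : support_fun base = ch.
Proof.
apply/funext => y; have [p [yp pE]] := tsum_min_horizontal y.
have [x [l [pxl _ _]]] := tsum_below yp.1; rewrite pxl in yp pE.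
have yx : min_face base y x by apply/min_face_base; exists l.
by rewrite (support_fun_min yx) -[RHS]opprK -pE dot_pt mulr0 addr0.
Qed.

(** A linear form that is constant on [base] lies together with its opposite in
    every normal cone, in particular in a maximal cone of [cSigma'], which is
    strongly convex. *)
Lemma base_full y : (forall s s', s \in [seq lsubmx s | s <- S] ->
  s' \in [seq lsubmx s | s <- S] -> dot s y <= dot s' y) -> y = 0.
Proof.
move=> yc; have [[fcS _ _] _] := crepcS; have [fin rcS _ _] := fcS.
have [C FC _] : fan_support cSigma' 0 by rewrite cSigma'_support.
have [M maxM _] := fan_maximal fin FC.
have [_ maxE] := ch_strict; have := maxM; rewrite maxE cSigma'_support.
move=> [linM maxlM].
have [|y0 [_ My0]] := linearity_domain_sub gen_base (E := M).
  by have [? _ ?] := linM; rewrite support_base; split.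
have nM : ncone base y0 = M.
  apply: maxlM => //; split=> //; first exact: ncone_cone gen_base (Tnil y0).
  by rewrite -support_base; apply: support_fun_linear gen_base (Tnil y0).
have [_ scM] := rcS M maxM.1; have [S0 SP _ _] := gen_base.
have cst z : (forall s s', s \in [seq lsubmx s | s <- S] ->
    s' \in [seq lsubmx s | s <- S] -> dot s z <= dot s' z) -> M z.
  move=> zc; rewrite -nM; apply/(nconeP _ gen_base (Tnil y0)); split=> // s sS _.
  exact: gen_min_face gen_base (Tnil z) sS (fun s' => zc s s' sS).
apply: scM; apply: cst => // s s' sS s'S.
by rewrite !dotNr lerN2; apply: yc.
Qed.

Lemma base_fan : normal_fan base = cSigma'.
Proof.
have [[fcS _ _] _] := crepcS; have [_ maxE] := ch_strict.
apply: fan_eq_maximal => //.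
  apply: (normal_fan_is_fan gen_base) => // [s|y _ _]; last exact: base_full.
  move=> /mapP[s' /int_tsum is' ->]; have [x [l sE]] := pt_surj s'.
  by rewrite sE row_mxKl; move: is'; rewrite sE => /lattice_pt[].
rewrite maxE cSigma'_support -support_base.
rewrite (normal_fan_strictly_convex gen_base).2 (normal_fan_support gen_base).
by congr (maximal_sets (linearity_domain _ _)); apply/seteqP; split.
Qed.

Lemma tsum_fan : is_fan (normal_fan tsum).
Proof.
apply: (normal_fan_is_fan gen_tsum int_tsum) => [t|y].
  by rewrite inE => /eqP->; apply/lattice_pt; split; [exact: lattice0|exact: rpred1].
have [x [l ->]] := pt_surj y => /halfspaces_up l0.
rewrite -scaleN1r ptZ => /halfspaces_up; rewrite mulN1r oppr_ge0 => l0'.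
have -> : l = 0 by apply/eqP; rewrite eq_le l0 l0'.
move=> hS; suff -> : x = 0 by rewrite pt0.
apply: base_full => _ _ /mapP[s sS ->] /mapP[s' s'S ->].
have := hS s s' sS s'S; have [a [b ->]] := pt_surj s; have [c [d ->]] := pt_surj s'.
by rewrite !dot_pt !mulr0 !addr0 !row_mxKl.
Qed.

Lemma slice_ncone z y : ncone tsum (pt z 0) (pt y 0) <-> ncone base z y.
Proof.
split=> [zy x x' /min_face_base[l zx] [l' x'l']|zy p p' zp tp'].
  by have := zy _ _ zx x'l'; rewrite !dot_pt !mulr0 !addr0.
have [x [l [pE _ _]]] := tsum_below zp.1; have [x' [l' [p'E _ _]]] := tsum_below tp'.
rewrite pE p'E in zp tp' *; rewrite !dot_pt !mulr0 !addr0; apply: zy.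
  by apply/min_face_base; exists l.
by exists l'.
Qed.

Lemma tsum_slices : [set [set y | C (pt y 0)] | C in normal_fan tsum] = cSigma'.
Proof.
rewrite -base_fan; apply/seteqP; split=> [_ [C + <-]|C].
  move=> /(normal_fanE _ gen_tsum)[y0 [Dy0 ->]].
  have CC := ncone_cone gen_tsum Dy0; have [C0 CD CZ] := CC.
  have CD' z : ncone tsum y0 z -> D' z.
    by move=> /(nconeP _ gen_tsum Dy0)[].
  (* the slice is the face on which the last coordinate vanishes *)
  have sliceE x l : (ncone tsum y0 (pt x l) /\ forall z, ncone tsum y0 z ->
      dot (pt x l) (pt 0 1) <= dot z (pt 0 1)) <-> ncone tsum y0 (pt x l) /\ l = 0.
    rewrite dot_pt dot0r add0r mulr1; split=> -[Cxl hl]; split=> //.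
      apply/eqP; rewrite eq_le; have := hl _ C0; rewrite dot0l => -> /=.
      by have /CD'/halfspaces_up := Cxl.
    move=> z /CD'; have [a [b ->]] := pt_surj z => /halfspaces_up b0.
    by rewrite dot_pt dot0r add0r mulr1 hl.
  have fC : face (ncone tsum y0) [set x | ncone tsum y0 x /\
      forall x', ncone tsum y0 x' -> dot x (pt 0 1) <= dot x' (pt 0 1)].
    split; last by exists (pt 0 1).
    by exists (pt 0 0); apply/sliceE; rewrite pt0.
  have [z [y0z FE]] := face_ncone gen_tsum Dy0 fC.
  have [x [l zE]] := pt_surj z; rewrite zE in y0z FE.
  have l0 : l = 0.
    have : ncone tsum (pt x l) (pt x l) by apply: ncone_refl.
    by rewrite -FE => /sliceE[].
  rewrite l0 in y0z FE; apply/(normal_fanE _ gen_base); exists x; split=> //.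
  apply/seteqP; split=> y /=.
    move=> y0y; apply/slice_ncone; rewrite -FE; exact/sliceE.
  by move=> /slice_ncone; rewrite -FE => /sliceE[].
move=> /(normal_fanE _ gen_base)[z [_ ->]]; exists (ncone tsum (pt z 0)).
  by apply/(normal_fanE _ gen_tsum); exists (pt z 0); split=> //; apply: D'P.
by apply/seteqP; split=> y /slice_ncone.
Qed.

Lemma tsum_subdivision : subdivision (normal_fan tsum) (normal_fan tnabla).
Proof.
split; first exact: tsum_fan.
  by rewrite (normal_fan_support gen_tsum) (normal_fan_support gen_tn).
move=> _ /(normal_fanE _ gen_tsum)[y [Dy ->]]; exists (ncone tnabla y).
  by apply/(normal_fanE _ gen_tn); exists y.
have [q _ yq] := gen_argmin gen_tn' Dy.
apply: ncone_summand => x x' yx Tx'; exists q; split; first exact: min_face_add.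
by exists x' => //; exists q => //; have [] := yq.
Qed.

(** Let [A] be the generators of [tsum] on which [(m, 1)] is minimal; [th'] is
    affine on the convex hull of their projections.  A slope [(qm, ql)] of [th'] at
    their barycentre is therefore a slope at all of them, and [(- qm, 1)] is
    minimal on [A] as well, so that it lies on the given ray and equals [(m, 1)].
    Thus [- m] comes from the slope of [th'] on a full-dimensional cone. *)
Lemma tsum_ray m : ncone tsum (pt m 1) `<=` ray (pt m 1) ->
  integral m /\ newton h' m.
Proof.
move=> rm; have Dm : D' (pt m 1) by apply: D'P.
have [S0 SP _ _] := gen_tsum.
pose A := [seq s <- S | `[< min_face tsum (pt m 1) s >]].
pose xs := (fun s : 'rV[R]_(n + 1) => lsubmx s : 'rV[R]_n).
have [s0 s0S ms0] := gen_argmin gen_tsum Dm; set mu := dot s0 (pt m 1).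
have muE s : min_face tsum (pt m 1) s -> dot s (pt m 1) = mu.
  by move=> ms; apply: min_faceE ms ms0.
have low x : newton ch x -> mu <= dot x m + th' (pt x 1).
  by move=> /tsum_graph/ms0.2; rewrite dot_pt mulr1.
clearbody mu.
have AE s : s \in A -> [/\ s = pt (xs s) (th' (pt (xs s) 1)), newton ch (xs s)
    & th' (pt (xs s) 1) = mu - dot (xs s) m].
  rewrite mem_filter => /andP[/asboolP ms sS].
  have [x [l [sE hx xl]]] := tsum_below (SP s sS).
  have := muE s ms; have := low x hx; rewrite /xs sE row_mxKl dot_pt mulr1 => h1 h2.
  have lE : l = th' (pt x 1) by apply/eqP; rewrite eq_le xl andbT; lra.
  by rewrite {1}lE; split=> //; rewrite -lE -h2 addrC addKr.
pose z := \sum_(s <- A) pt (xs s) 1.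
have Dz : D' z.
  apply: cone_sum; first exact: halfspaces_cone.
  by move=> s _; apply: D'P.
have [|||||q [C [FC Cz fC hq qle]]] := @convex_slope _ _ tSigma' th' z tSigma'_fan.
- by rewrite tSigma'_support; apply: halfspaces_cone.
- move=> w; rewrite tSigma'_support; have [x [l ->]] := pt_surj w.
  have [l0|l0] := leP 0 l; [left|right]; first exact: D'P.
  by rewrite -scaleN1r ptZ; apply: D'P; rewrite mulN1r oppr_ge0 ltW.
- exact: th'_pl.
- by rewrite tSigma'_support; apply: th'_convex.
- by rewrite tSigma'_support.
have {}qle x : D' x -> dot q x <= th' x by rewrite -tSigma'_support; apply: qle.
have s0A : s0 \in A by rewrite mem_filter s0S andbT; apply/asboolP.
have A0 : 0 < (size A)%:R :> R by rewrite ltr0n; case: (A) s0A.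
pose x := (size A)%:R^-1 *: \sum_(s <- A) xs s.
have zE : z = (size A)%:R *: pt x 1.
  rewrite /z pt_sum ptZ /x scalerA mulfV ?gt_eqF // scale1r mulr1.
  by rewrite big_const_seq count_predT iter_addr_0.
have hx : newton ch x.
  move=> y; rewrite /x dotZl ler_pdivlMl // dot_suml.
  have -> : (size A)%:R * - ch y = \sum_(s <- A) - ch y.
    by rewrite big_const_seq count_predT iter_addr_0 mulr_natl.
  rewrite big_seq [leRHS]big_seq; apply: ler_sum => s /AE[_ hs _].
  exact: hs.
have qA s : s \in A -> th' (pt (xs s) 1) = dot q (pt (xs s) 1).
  move=> sA; apply/eqP; rewrite -subr_eq0; apply/eqP; move: s sA.
  apply: (sumr_le0_mem (f := fun s => th' (pt (xs s) 1) - dot q (pt (xs s) 1))).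
    by move=> s _; rewrite subr_ge0; apply/qle/D'P.
  rewrite sumrB -dot_sumr -/z -hq // zE th'Z ?ler0n //; last exact: D'P.
  have -> : \sum_(s <- A) th' (pt (xs s) 1) = (size A)%:R * (mu - dot x m).
    rewrite (eq_big_seq (fun s => mu - dot (xs s) m)) => [|s /AE[]//].
    rewrite sumrB -dot_suml big_const_seq count_predT iter_addr_0 -[mu *+ _]mulr_natl.
    by rewrite mulrBr /x dotZl mulrA mulfV ?gt_eqF // mul1r.
  by rewrite -mulrBr mulr_ge0_le0 // ?ler0n //; have := low x hx; lra.
have [qm [ql qE]] := pt_surj q; rewrite {}qE in hq qle qA.
have mq : ncone tsum (pt m 1) (pt (- qm) 1).
  apply/(nconeP _ gen_tsum Dm); split=> [|s sS ms|t].
  - exact: D'P.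
  - have sA : s \in A by rewrite mem_filter sS andbT; apply/asboolP.
    have [sE _ _] := AE s sA; split; first exact: SP.
    move=> _ /tsum_below[y [l [-> hy yl]]]; rewrite sE !dot_pt qA //.
    have := qle _ (D'P y ler01); rewrite !dot_pt !dotNr (dotC qm) (dotC qm); lra.
  - rewrite inE => /eqP->; rewrite dot_pt dot0l add0r mulr1 => /eqP.
    by rewrite oner_eq0.
have [t _] := rm _ mq; rewrite ptZ => /pt_inj[mE]; rewrite mulr1 => t1.
move: mE; rewrite -t1 scale1r => mE; rewrite -mE; split.
  apply: latticeN; suff /lattice_pt[] : integral (pt qm ql) by [].
  have [_ rF _ _] := tSigma'_fan; apply: lattice_slope (rF C FC).1 fC _ => y Cy iy.
  by rewrite -hq //; apply: th'_lattice => //; apply: D'_of Cy.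
move=> y; have := qle _ (D'P y (lexx 0)); rewrite th'_horizontal dot_pt mulr0 addr0.
by rewrite dotNl lerN2.
Qed.

Lemma tsum_rays C : normal_fan tsum C -> is_ray C ->
  ~ (C `<=` [set pt y 0 | y in setT]) ->
  exists q, [/\ newton h' q, primitive (pt q 1) & C = ray (pt q 1)].
Proof.
move=> FC [v v0 Cv] nC; have := FC; rewrite Cv => /(normal_fanE _ gen_tsum)[y [Dy yE]].
have yv : ncone tsum y v by rewrite -yE; apply: ray_mem.
have [Dv _ _] := (nconeP _ gen_tsum Dy).1 yv.
have [m [l vE]] := pt_surj v; rewrite vE in Dv.
have l0 : 0 < l.
  move/halfspaces_up: Dv; rewrite le_eqVlt => /predU1P[l0|//].
  case: nC; rewrite Cv => _ [t t0 ->]; exists (t *: m) => //.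
  by rewrite vE -l0 ptZ mulr0.
have rE : ray v = ray (pt (l^-1 *: m) 1).
  have -> : pt (l^-1 *: m) 1 = l^-1 *: v by rewrite vE ptZ mulVf ?gt_eqF.
  apply/seteqP; split=> _ [t t0 ->].
    exists (t * l); first by rewrite mulr_ge0 // ltW.
    by rewrite scalerA mulfK ?gt_eqF.
  exists (t * l^-1); last by rewrite scalerA.
  by rewrite mulr_ge0 // invr_ge0 ltW.
set q := l^-1 *: m in rE; have yq : ncone tsum y (pt q 1).
  by rewrite -yE rE; apply: ray_mem.
have [|iq hq] := @tsum_ray q.
  by rewrite -rE yE; apply: ncone_trans gen_tsum Dy yq.
exists q; split=> //; split; first by apply/lattice_pt; rewrite rpred1.
move=> k w; have [a [b ->]] := pt_surj w => /lattice_pt[_ ib].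
rewrite ptZ => /pt_inj[_ kb].
have b1 : 1 <= `|b|.
  by rewrite norm_intr_ge1 //; apply: contra_eq_neq kb => ->; rewrite mulr0 oner_neq0.
have k1 : (k <= 1)%N.
  have kb' : k%:R * `|b| = 1 by rewrite -(normr_nat R k) -normrM -kb normr1.
  by rewrite -(ler_nat R) -[leRHS]kb' ler_peMr ?ler0n.
by case: k k1 kb => [_|[|]//]; rewrite mul0r => /eqP; rewrite oner_eq0.
Qed.

Lemma support_tsum y : D' y ->
  support_fun tsum y = support_fun tnabla y + support_fun tnabla' y.
Proof.
move=> Dy; have [a _ ya] := gen_argmin gen_tn Dy; have [b _ yb] := gen_argmin gen_tn' Dy.
rewrite (support_fun_min (min_face_add ya yb)) (support_fun_min ya).
by rewrite (support_fun_min yb) dotDl opprD.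
Qed.

Lemma tsum_good :
  good tnabla (newton h') cSigma' ch (normal_fan tsum) (support_fun tsum).
Proof.
split; first by split; [exact: tsum_subdivision|exact: tsum_slices|exact: tsum_rays].
split.
- split=> [C /(normal_fanE _ gen_tsum)[y [Dy ->]]|v].
    exact: support_fun_linear gen_tsum Dy.
  rewrite (normal_fan_support gen_tsum).
  exact: support_fun_lattice gen_tsum int_tsum.
- exact: tsum_horizontal.
- exact: normal_fan_strictly_convex gen_tsum.
- rewrite (normal_fan_support gen_tsum) => x y Dx Dy.
  have [_ DD _] := halfspaces_cone (upward R n).
  rewrite /= !support_tsum //; last exact: DD.
  have := support_funD gen_tn' Dx Dy; lra.
Qed.

End GoodDual.

(** * The theorem *)

Unset Implicit Arguments.

Theorem theorem3p21 (R : realType) (n r : nat)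
    (Delta : set 'rV[R]_n) (Deltas : 'I_r -> set 'rV[R]_n)
    (phi : 'rV[R]_n -> R)
    (Sigma' cSigma' : set (set 'rV[R]_n)) (h ch : 'rV[R]_n -> R)
    (tSigma' : set (set 'rV[R]_(n + 1))) (th : 'rV[R]_(n + 1) -> R) :
  let Sigma := normal_fan Delta in
  let nabla_ := nablas Delta Deltas in
  let nabla := minkowski_sum nabla_ in
  let cSigma := normal_fan nabla in
  let cphi := fun x => \sum_(i < r) support_fun (nabla_ i) x in
  let h' := h \- phi in
  let ch' := ch \- cphi in
  let tDelta := minkowski_sum (fun i => epigraph (Deltas i) ch') in
  let th' := th \- support_fun tDelta in
  let tnabla := epigraph nabla h' in
  let tnabla' := epigraph (newton ch') (fun y => th' (pt y 1)) in
  let tsum := [set x + y | x in tnabla & y in tnabla'] in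
  (0 < r)%N ->
  reflexive_polytope Delta ->
  nef_partition Delta Deltas ->
  piecewise_linear Sigma phi ->
  (forall e, ray_generators Sigma e -> phi e = 1) ->
  crepant_subdivision (polar Delta) Sigma' Sigma ->
  crepant_subdivision (polar nabla) cSigma' cSigma ->
  integral_piecewise_linear Sigma' h ->
  strictly_convex Sigma' h ->
  convex_on setT h' ->
  integral_piecewise_linear cSigma' ch ->
  strictly_convex cSigma' ch ->
  convex_on setT ch' ->
  good tDelta (newton ch') Sigma' h tSigma' th ->
  good tnabla (newton h') cSigma' ch (normal_fan tsum) (support_fun tsum).
Proof.
move=> Sigma nabla_ nabla cSigma cphi h' ch' tDelta th' tnabla tnabla' tsum.
move=> r0 refl nef phi_pl phi1 crepS crepcS h_pl h_strict h'c ch_pl ch_strict ch'c.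
move=> good_th; have [DE _ _] := nef.
have [GD [GN [pD pN phiE DW NW]]] := nef_duality refl nef phi_pl phi1.
have [[SD hSD] _] := gen_epigraphs r0 pN crepcS DW ch_pl (k := ch') (fun=> erefl).
have gen_tD i := (hSD i).1; have int_tD i := (hSD i).2.
have h'E x : h' x = h x - \sum_i support_fun (Deltas i) x by rewrite /h' /= phiE.
have crepS' : crepant_subdivision (polar (minkowski_sum Deltas)) Sigma'
    (normal_fan (minkowski_sum Deltas)) by rewrite -DE.
have [_ /(_ h'c)[Stn [gen_tn int_tn]]] := gen_epigraphs r0 pD crepS' NW h_pl h'E.
have [V [intV raysV]] := vertical_rays good_th.
have [Stn' [gen_tn' int_tn']] := gen_tnabla' r0 refl nef crepS crepcS ch_pl
  good_th pD pN gen_tD int_tD intV raysV.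
exact (tsum_good r0 nef crepS crepcS ch_pl ch_strict ch'c good_th pD pN phiE DW
  NW gen_tD int_tD intV raysV gen_tn int_tn gen_tn' int_tn').
Qed.
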